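(* Let $\xi=(\xi_t)_{t\ge 0}$ be a Lévy process starting from $0$ under $\mathbb P$, with $\mathbb E\,\xi_1$ finite and positive, and let $(X,(\mathbb Q_a)_{a>0})$ be the associated positive self-similar Markov process of index $1$, with clock $T^{(X)}(t)=\int_0^t \frac{ds}{X_s}$. Then for every $a>0$, $$\frac{T^{(X)}(t)}{\log t}\ \longrightarrow\ (\mathbb E\,\xi_1)^{-1}\quad\text{as } t\to\infty,\qquad \mathbb Q_a\text{-almost surely},$$ or, equivalently, with $\tau^{(\xi)}(t)=\inf\{u\ge 0:\int_0^u e^{\xi_s}\,ds\ge t\}$, $$\frac{\tau^{(\xi)}(t)}{\log t}\ \longrightarrow\ (\mathbb E\,\xi_1)^{-1}\quad\text{as } t\to\infty,\qquad \mathbb P\text{-almost surely}.$$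
   Context: A positive self-similar Markov process (pssMp) of index $1$ is a $[0,\infty)$-valued càdlàg strong Markov process $(X,(\mathbb Q_a)_{a>0})$, where $\mathbb Q_a$ is the law of $X$ started at $a$, such that for all $a,b>0$ the law of $(bX_{b^{-1}t})_{t\ge0}$ under $\mathbb Q_a$ equals the law of $(X_t)_{t\ge 0}$ under $\mathbb Q_{ba}$. Lamperti correspondence (index $1$): let $\xi$ be a real Lévy process with $\xi_0=0$ under a probability $\mathbb P$ (expectation $\mathbb E$), with $\limsup_{t\to\infty}\xi_t=\infty$ (automatic when $\mathbb E\xi_1>0$). Put $\mathcal A^{(\xi)}(t)=\int_0^t e^{\xi_s}\,ds$ and $\tau^{(\xi)}(t)=\inf\{u\ge0:\mathcal A^{(\xi)}(u)\ge t\}$. For $a>0$, $\mathbb Q_a$ is defined as the law under $\mathbb P$ of $$X_t=a\exp\left(\xi_{\tau^{(\xi)}(t/a)}\right),\qquad t\ge0 .$$ Then $(X,(\mathbb Q_a)_{a>0})$ is a pssMp of index $1$ which never reaches $0$ (the one associated with $\xi$), and every such pssMp arises in this way. The clock is $T^{(X)}(t)=\int_0^t X_s^{-1}ds$, and $\tau^{(\xi)}(t)=T^{(X)}(tX_0)$ for all $t\ge0$. *)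

(* Defs.v *)
From HB Require Import structures.
From mathcomp Require Import all_boot all_order all_algebra.
From mathcomp Require Import all_classical all_reals all_analysis.

Set Implicit Arguments.
Unset Strict Implicit.
Unset Printing Implicit Defensive.

Import Order.TTheory GRing.Theory Num.Theory.
Import numFieldNormedType.Exports.

Local Open Scope classical_set_scope.
Local Open Scope ring_scope.

(* Time is indexed by [R]; everywhere below only the times [0 <= t] matter. *)

Definition cadlag (R : realType) (x : R -> R) : Prop :=
  (forall t, 0 <= t -> x s @[s --> t^'+] --> x t) /\
  (forall t, 0 < t -> cvg (x s @[s --> t^'-])).

Definition mutually_independent (d : measure_display) (T : measurableType d)
    (R : realType) (P : probability T R) (n : nat) (X : 'I_n -> T -> R) : Prop :=
  forall B : 'I_n -> set R, (forall i, measurable (B i)) ->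
    P (\bigcap_(i in [set: 'I_n]) (X i @^-1` B i)) =
    (\prod_(i < n) P (X i @^-1` B i))%E.

Record levy_process (d : measure_display) (T : measurableType d)
    (R : realType) (P : probability T R) (xi : R -> T -> R) : Prop := LevyProcess {
  levy_measurable : forall t, 0 <= t -> measurable_fun [set: T] (xi t) ;
  levy_start0 : {ae P, forall w, xi 0 w = 0} ;
  levy_cadlag : {ae P, forall w, cadlag (fun t => xi t w)} ;
  levy_independent : forall (n : nat) (t : nat -> R),
    0 <= t 0%N -> (forall i, t i <= t i.+1) ->
    mutually_independent P (fun i : 'I_n => fun w => xi (t i.+1) w - xi (t i) w) ;
  levy_stationary : forall s t : R, 0 <= s -> 0 <= t ->
    forall B : set R, measurable B ->
      P ((fun w => xi (s + t) w - xi s w) @^-1` B) = P (xi t @^-1` B)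
}.

(* The space of cadlag paths from [0, oo) to [0, oo), with the sigma-algebra
   generated by the evaluations at nonnegative times. *)
Record path_space (R : realType) := PathSpace {
  path_fun :> R -> R ;
  path_ge0 : forall t, 0 <= t -> 0 <= path_fun t ;
  path_cadlag : cadlag path_fun
}.

Lemma cadlag_cst (R : realType) (c : R) : cadlag (fun=> c).
Proof. by split => t _; [exact: cvg_cst | exact: is_cvg_cst]. Qed.

Definition path_cst0 (R : realType) : path_space R :=
  @PathSpace R (fun=> 0) (fun t _ => lexx 0) (cadlag_cst 0).

HB.instance Definition _ (R : realType) := gen_eqMixin (path_space R).
HB.instance Definition _ (R : realType) := gen_choiceMixin (path_space R).
HB.instance Definition _ (R : realType) :=
  isPointed.Build (path_space R) (path_cst0 R).

Definition path_evaluations (R : realType) : set (set (path_space R)) :=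
  [set C | exists t : R, exists B : set R,
    [/\ 0 <= t, measurable B & C = [set x : path_space R | B (x t)]]].

HB.instance Definition _ (R : realType) :=
  Measurable.copy (path_space R) (g_sigma_algebraType (@path_evaluations R)).

(* [Q] is the law on path space of a process [X] whose paths are almost surely
   in path space: [Y] is indistinguishable from [X] on [0 <= t] and has all
   its paths in path space. *)
Definition is_law_of (d : measure_display) (T : measurableType d)
    (R : realType) (P : probability T R) (X : R -> T -> R)
    (Q : probability (path_space R) R) : Prop :=
  exists Y : {mfun T >-> path_space R},
    {ae P, forall w, forall t, 0 <= t -> Y w t = X t w} /\
    forall C : set (path_space R), measurable C -> Q C = distribution P Y C.

Definition exp_functional (R : realType) (xi : R -> R) (u : R) : \bar R :=
  (\int[lebesgue_measure]_(s in `[0%R, u]) (expR (xi s))%:E)%E.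

(* The infimum of the empty set is [+oo]. *)
Definition tau (R : realType) (xi : R -> R) (t : R) : \bar R :=
  ereal_inf [set u%:E | u in [set u : R | 0 <= u /\ (t%:E <= exp_functional xi u)%E]].

(* The value is irrelevant where [tau] is infinite, which almost surely does not
   happen when [limsup xi = +oo]. *)
Definition lamperti (R : realType) (a : R) (xi : R -> R) (t : R) : R :=
  a * expR (xi (fine (tau xi (t / a)))).

(* [Q a] is the law, started at [a], of the positive self-similar Markov process
   of index 1 associated with the Levy process [xi]. *)
Definition associated_pssMp (d : measure_display) (T : measurableType d)
    (R : realType) (P : probability T R) (xi : R -> T -> R)
    (Q : R -> probability (path_space R) R) : Prop :=
  forall a : R, 0 < a ->
    is_law_of P (fun t w => lamperti a (fun s => xi s w) t) (Q a).

(* Inverse in the extended reals: [0^-1 = +oo]. *)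
Definition clock (R : realType) (x : R -> R) (t : R) : \bar R :=
  (\int[lebesgue_measure]_(s in `[0%R, t]) ((x s)%:E)^-1)%E.

(* Main.v *)
From HB Require Import structures.
Require Import Defs.
From mathcomp Require Import all_boot all_order all_algebra.
From mathcomp Require Import all_classical all_reals all_analysis.
From mathcomp Require Import measurable_realfun.
From mathcomp Require Import zify ring lra.

Set Implicit Arguments.
Unset Strict Implicit.
Unset Printing Implicit Defensive.

Import Order.TTheory GRing.Theory Num.Theory.
Import numFieldNormedType.Exports.

Local Open Scope classical_set_scope.
Local Open Scope ring_scope.

(** Let [m = E xi_1] and [A u = int_0^u exp xi_s ds].  If a Levy process [Z] has
    [E Z_1 < 0], then almost surely it is bounded above: for its integer
    skeleton, an i.i.d. walk, this is the maximal ergodic inequality on the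
    sequence space, since on the shift-invariant event where the walk is
    unbounded the first step, which is independent of it, would have a
    nonnegative mean; Ottaviani's inequality then passes from the integers to
    the dyadic times, uniformly in the mesh, and right continuity to all times.
    Applied to [xi_t - (m + e) t] and to [(m - e) t - xi_t] this gives
    [|xi_t - m t| <= K_e + e t], whence [log A u = m u + o (u)] and
    [tau t = m^-1 log t + o (log t)] for the inverse [tau] of [A].  The clock
    of the Lamperti transform of [xi] started at [a] is exactly
    [t |-> tau (t / a)], by the change of variables [u = tau (s / a)].  As the
    clock is nondecreasing, its growth is decided at the integers, so that it
    defines a measurable set of paths and transfers to [Q_a]. *)

(** * Integrals over an event independent of the integrand *)

Lemma ge0_integral_mrestr d (T : measurableType d) (R : realType)
    (mu : {measure set T -> \bar R}) (A : set T) (mA : measurable A)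
    (f : T -> \bar R) :
  measurable_fun [set: T] f -> (forall x, 0 <= f x)%E ->
  (\int[mrestr mu mA]_x f x = \int[mu]_(x in A) f x)%E.
Proof.
move=> mf f0.
rewrite (@ge0_negligible_integral _ _ _ _ setT (~` A))//; last 2 first.
- exact: measurableC.
- by rewrite /= /mrestr setICl measure0.
rewrite setTD setCK; apply: eq_measure_integral => B mB BA.
by rewrite /= /mrestr setIidl.
Qed.

(** Independence says that the image under [Y] of [mu] restricted to [A] is [mu A] times the image
    of [mu]; both sides become integrals of [f] against these image measures. *)
Lemma ge0_integral_indep d (T : measurableType d) (R : realType)
    (mu : probability T R) (A : set T) (Y : T -> R) (f : R -> \bar R) :
  measurable A -> measurable_fun [set: T] Y ->
  measurable_fun [set: R] f -> (forall y, 0 <= f y)%E ->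
  (forall B, measurable B -> mu (A `&` Y @^-1` B) = (mu A * mu (Y @^-1` B))%E) ->
  (\int[mu]_(x in A) f (Y x) = mu A * \int[mu]_x f (Y x))%E.
Proof.
move=> mA mY mf f0 AY.
have k0 : (0 <= fine (mu A)) by rewrite fine_ge0.
pose k := NngNum k0.
have muA : k%:num%:E = mu A by rewrite /= fineK// fin_num_measure.
have push (m : {measure set T -> \bar R}) := ge0_integral_pushforward mY m
  measurableT mf (fun y _ => f0 y).
rewrite -(ge0_integral_mrestr _ mA); last 2 first.
- exact: measurableT_comp.
- by move=> x; exact: f0.
rewrite -[LHS]push -[in RHS]push.
rewrite -[in RHS]muA -ge0_integral_mscale//.
apply: eq_measure_integral => B mB _.
have h : mu (Y @^-1` B `&` A) = (k%:num%:E * mu (Y @^-1` B))%E.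
  by rewrite setIC muA AY.
exact: h.
Qed.

Lemma integral_indep d (T : measurableType d) (R : realType)
    (mu : probability T R) (A : set T) (Y : T -> R) :
  measurable A -> mu.-integrable [set: T] (EFin \o Y) ->
  (forall B, measurable B -> mu (A `&` Y @^-1` B) = (mu A * mu (Y @^-1` B))%E) ->
  (\int[mu]_(x in A) (Y x)%:E = mu A * \int[mu]_x (Y x)%:E)%E.
Proof.
move=> mA iY AY.
have mY : measurable_fun setT Y by apply/measurable_EFinP; exact: measurable_int iY.
have mE : measurable_fun [set: R] (@EFin R) by exact: EFin_measurable.
have hp : (\int[mu]_(x in A) (EFin \o Y)^\+ x =
    mu A * \int[mu]_x (EFin \o Y)^\+ x)%E.
  rewrite funepos_comp; exact: ge0_integral_indep mA mY
    (measurable_funepos mE) (fun=> funepos_ge0 _ _) AY.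
have hn : (\int[mu]_(x in A) (EFin \o Y)^\- x =
    mu A * \int[mu]_x (EFin \o Y)^\- x)%E.
  rewrite funeneg_comp; exact: ge0_integral_indep mA mY
    (measurable_funeneg mE) (fun=> funeneg_ge0 _ _) AY.
rewrite [LHS]integralE [in RHS]integralE.
rewrite muleBr; [by rewrite -hp -hn| |].
- exact: fin_num_measure.
- by rewrite fin_num_adde_defr// integrable_pos_fin_num.
Qed.

(** * The maximal ergodic inequality for a measure-preserving map *)

Section bounded_walk.
Context d (T : measurableType d) (R : realType) (mu : probability T R).
Variables (theta : {mfun T >-> T}) (Y : T -> R).

(* The maximum of [0] and of the first [n] partial sums of the
   [Y (theta^i w)], unfolded from the first step. *)
Fixpoint walk_max (n : nat) (w : T) : R :=
  if n is m.+1 then Num.max 0 (Y w + walk_max m (theta w)) else 0.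

Hypothesis theta_mu : forall A, measurable A -> mu (theta @^-1` A) = mu A.
Hypothesis intY : mu.-integrable [set: T] (EFin \o Y).

Lemma walk_max_ge0 n w : 0 <= walk_max n w.
Proof. by case: n => //= n; rewrite le_max lexx. Qed.

Lemma walk_max_nondecreasing w : nondecreasing_seq (walk_max ^~ w).
Proof.
apply/nondecreasing_seqP => n; elim: n w => [|n IH] w; first exact: walk_max_ge0.
by rewrite [leLHS]/= [leRHS]/= ge_max !le_max lexx/= lerD2l IH orbT.
Qed.

Let mY : measurable_fun [set: T] Y.
Proof. by apply/measurable_EFinP; exact: measurable_int intY. Qed.

Lemma measurable_walk_max n : measurable_fun [set: T] (walk_max n).
Proof.
elim: n => [|n IH]; first exact: measurable_cst.
apply: measurable_maxr; first exact: measurable_cst.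
by apply: measurable_funD => //; exact: measurableT_comp.
Qed.

Lemma integrable_shift (f : T -> R) : mu.-integrable [set: T] (EFin \o f) ->
  mu.-integrable [set: T] (EFin \o (f \o theta)).
Proof.
move=> /integrableP[mf intf]; apply/integrableP; split.
  by apply/measurable_EFinP; apply: measurableT_comp => //; exact/measurable_EFinP.
apply: le_lt_trans intf.
rewrite (_ : integral _ _ _ = (\int[pushforward mu theta]_x `|(f x)%:E|)%E).
  rewrite le_eqVlt; apply/orP; left; apply/eqP.
  by apply: eq_measure_integral => A mA _; exact: theta_mu.
by rewrite ge0_integral_pushforward//; exact: measurableT_comp.
Qed.

Lemma integral_shift (A : set T) (f : T -> R) :
  measurable A -> theta @^-1` A = A -> mu.-integrable [set: T] (EFin \o f) ->
  (\int[mu]_(x in A) (f (theta x))%:E = \int[mu]_(x in A) (f x)%:E)%E.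
Proof.
move=> mA tA intf.
transitivity (\int[pushforward mu theta]_(x in A) (f x)%:E)%E; last first.
  by apply: eq_measure_integral => B mB _; exact: theta_mu.
rewrite integral_pushforward//; first by rewrite tA.
  exact: measurable_int intf.
apply: (integrableS measurableT) => //.
  by rewrite tA.
exact: integrable_shift.
Qed.

Lemma integrable_walk_max n : mu.-integrable [set: T] (EFin \o walk_max n).
Proof.
elim: n => [|n IH].
  by apply: (eq_integrable _ (cst 0%E)) => //; exact: integrable0.
(* The next maximum lies between [0] and this function. *)
have h : mu.-integrable setT (fun x => `|(Y x)%:E| + (walk_max n (theta x))%:E)%E.
  apply: integrableD => //; first exact: integrable_abse intY.
  exact: integrable_shift IH.
apply: le_integrable h => //.
  by apply/measurable_EFinP; exact: measurable_walk_max.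
move=> w _ /=; rewrite lee_fin [leRHS]ger0_norm; last first.
  by rewrite addr_ge0// walk_max_ge0.
rewrite ger0_norm ?le_max ?lexx// ge_max addr_ge0 ?walk_max_ge0//=.
by rewrite lerD2r ler_norm.
Qed.

Definition unbounded_walk : set T :=
  [set w | forall K : nat, exists n, K%:R < walk_max n w].

Lemma measurable_unbounded_walk : measurable unbounded_walk.
Proof.
rewrite (_ : unbounded_walk =
    \bigcap_(K in setT) \bigcup_(n in setT) [set w | K%:R < walk_max n w]).
  apply: bigcapT_measurable => K; apply: bigcupT_measurable => n.
  rewrite (_ : [set _ | _] = setT `&` walk_max n @^-1` `]K%:R, +oo[%classic).
    exact: measurable_walk_max.
  by rewrite setTI; apply/seteqP; split => w /=; rewrite in_itv/= andbT.
apply/seteqP; split => w /=.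
  by move=> h K _; have [n] := h K; exists n.
by move=> h K; have [n _] := h K I; exists n.
Qed.

(** Dropping the first step changes the maximum by at most [|Y w|], so it suffices to ask one walk
    for a level higher than [K] by that amount. *)
Lemma shift_unbounded_walk : theta @^-1` unbounded_walk = unbounded_walk.
Proof.
apply/seteqP; split => w /= h K.
  have [n hn] := h (Num.truncn (`|Y w| + K%:R)).+1; exists n.+1 => /=.
  rewrite lt_max; apply/orP; right.
  have : `|Y w| + K%:R < (Num.truncn (`|Y w| + K%:R)).+1%:R.
    by rewrite real_truncnS_gt// num_real.
  have := ler_norm (- Y w); rewrite normrN; lra.
have [[|n] /=] := h (Num.truncn (`|Y w| + K%:R)).+1.
  by move=> /ltW; rewrite leNgt ltr0n.
rewrite lt_max ltNge ler0n/= => hn; exists n.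
have : `|Y w| + K%:R < (Num.truncn (`|Y w| + K%:R)).+1%:R by rewrite real_truncnS_gt// num_real.
have := ler_norm (Y w); lra.
Qed.

(* Garsia's maximal inequality argument: on the invariant set where the
   maximum diverges, [M_(n+1) - M_n o theta = max (- M_n o theta) Y] tends to
   [Y], while its integral is nonnegative since [M] is nondecreasing. *)
Lemma integral_unbounded_walk :
  (0 <= \int[mu]_(x in unbounded_walk) (Y x)%:E)%E.
Proof.
set A := unbounded_walk.
have mA : measurable A := measurable_unbounded_walk.
pose f n w := Num.max (- walk_max n (theta w)) (Y w).
have fE n w : f n w = walk_max n.+1 w - walk_max n (theta w).
  by rewrite /f /= addr_maxl sub0r addrK.
have mf n : measurable_fun setT (f n).
  apply: measurable_maxr => //; apply: measurable_funN.
  by apply: measurableT_comp => //; exact: measurable_walk_max.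
have intA g : mu.-integrable setT (EFin \o g) -> mu.-integrable A (EFin \o g).
  exact: integrableS.
have [_ _] : [/\ mu.-integrable A (EFin \o Y),
    [sequence \int[mu]_(x in A) `|(f n x)%:E - (Y x)%:E|]_n @ \oo --> 0 &
    [sequence \int[mu]_(x in A) (f n x)%:E]_n @ \oo -->
      \int[mu]_(x in A) (Y x)%:E]%E.
  apply: (@dominated_convergence _ _ _ mu A mA (fun n x => (f n x)%:E)
    (EFin \o Y) (fun x => `|(Y x)%:E|%E)).
  - by move=> n; apply/measurable_EFinP; exact: measurable_funTS.
  - by apply/measurable_EFinP; exact: measurable_funTS.
  - apply: aeW => w Aw; apply: cvg_EFin; first exact: nearW.
    (* Once the maximum at [theta w] exceeds [|Y w|], the sequence is constantly [Y w]. *)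
    apply: (cvg_near_cst (Y w)).
    have : (theta @^-1` A) w by rewrite shift_unbounded_walk.
    move=> /(_ (Num.truncn `|Y w|).+1)[N hN].
    exists N => // n /= Nn; rewrite /f.
    apply: max_r.
    have := walk_max_nondecreasing (theta w) Nn.
    have : `|Y w| < (Num.truncn `|Y w|).+1%:R by rewrite real_truncnS_gt// num_real.
    have := ler_norm (- Y w); rewrite normrN; lra.
  - exact: integrable_abse (intA _ intY).
  (* When [Y w] is below [- walk_max n (theta w)], both are nonpositive, so the larger one has the
     smaller absolute value. *)
  - apply: aeW => w n _; rewrite lee_fin /f.
    have := walk_max_ge0 n (theta w).
    have [h _|h M0] := leP (- walk_max n (theta w)) (Y w).
      by [].
    have := ler_norm (- Y w); rewrite !normrN (ger0_norm M0); lra.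
move=> cv; apply: cvge_ge cv.
apply: nearW => n /=.
under eq_integral do rewrite fE EFinB.
rewrite integralB//; last 2 first.
- exact: (intA _ (integrable_walk_max _)).
- exact: (intA _ (integrable_shift (integrable_walk_max _))).
rewrite integral_shift//; [|exact: shift_unbounded_walk|exact: integrable_walk_max].
rewrite sube_ge0; last first.
  by rewrite integrable_fin_num//; exact: (intA _ (integrable_walk_max _)).
apply: le_integral; [exact: mA|exact: (intA _ (integrable_walk_max _))..|].
by move=> w _; rewrite lee_fin; apply: walk_max_nondecreasing.
Qed.

(** The invariant event is its own preimage under [theta], hence independent of the first step [Y].
    The integral inequality then reads [0 <= mu A * E Y] with [E Y < 0]. *)
Lemma unbounded_walk_null :
  (\int[mu]_x (Y x)%:E < 0)%E ->
  (forall A B, measurable A -> measurable B ->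
    mu (theta @^-1` A `&` Y @^-1` B) = (mu A * mu (Y @^-1` B))%E) ->
  mu unbounded_walk = 0%E.
Proof.
move=> EY ind; have := integral_unbounded_walk.
have mA := measurable_unbounded_walk.
rewrite integral_indep//; last first.
  by move=> B mB; rewrite -ind// shift_unbounded_walk.
move=> h; apply/eqP; rewrite eq_le measure_ge0 andbT leNgt; apply/negP => A0.
by move: h; rewrite leNgt => /negP; apply; rewrite mule_gt0_lt0.
Qed.

End bounded_walk.

(** * Independence of generated sigma-algebras, and the space of real sequences *)

(** As functions of [E], the two sides are finite measures that agree on a pi-system containing the
    whole space. *)
Lemma g_sigma_algebra_indep d (T : measurableType d) (R : realType)
    (P : probability T R) (G : set (set T)) (F : set T) :
  G `<=` measurable -> G setT -> setI_closed G -> measurable F ->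
  (forall E, G E -> P (E `&` F) = (P E * P F)%E) ->
  forall E, <<s G >> E -> P (E `&` F) = (P E * P F)%E.
Proof.
move=> Gm GT GI mF GF E sE.
have k0 : 0 <= fine (P F) by rewrite fine_ge0.
pose k := NngNum k0.
have PF : k%:num%:E = P F by rewrite /= fineK// fin_num_measure.
suff h : mrestr P mF E = mscale k P E.
  by rewrite muleC -PF; exact: h.
apply: (g_sigma_algebra_measure_unique G Gm (fun=> setT)) => //.
- by rewrite bigcup_const//; exists 0%N.
- move=> A GA.
  have h : P (A `&` F) = (k%:num%:E * P A)%E by rewrite GF// PF muleC.
  exact: h.
- move=> _; have h : (P (setT `&` F) < +oo)%E.
    by rewrite ltey_eq fin_num_measure// setTI.
  exact: h.
Qed.

Definition cylinder (R : realType) (n : nat) (B : nat -> set R) : set (nat -> R) :=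
  [set u | forall i, (i < n)%N -> B i (u i)].

(** These boxes generate the product sigma-algebra. Constraining a whole initial segment, not one
    coordinate, makes them a pi-system. *)
Definition cylinders (R : realType) : set (set (nat -> R)) :=
  [set C | exists n B, (forall i, measurable (B i)) /\ C = cylinder n B].

Notation seq_space R := (g_sigma_algebraType (@cylinders R)).

Section sequence_space.
Context (R : realType).

Lemma cylindersT : @cylinders R setT.
Proof.
exists 0%N, (fun=> setT); split=> //.
by apply/seteqP; split.
Qed.

Lemma setI_closed_cylinders : setI_closed (@cylinders R).
Proof.
move=> _ _ [n [B [mB ->]]] [m [C [mC ->]]].
(* Boxes of different lengths are padded with the whole line to a common length. *)
pose pad n (B : nat -> set R) i := if (i < n)%N then B i else setT.
have mpad k D i : (forall i, measurable (D i)) -> measurable (pad k D i).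
  by rewrite /pad; case: ifP.
exists (maxn n m), (fun i => pad n B i `&` pad m C i); split.
  by move=> i; apply: measurableI; exact: mpad.
apply/seteqP; split => [u [uB uC] i _|u h]; rewrite /pad.
  by split; case: ifP => // ?; [exact: uB|exact: uC].
split=> i ilt.
  by have [|+ _] := h i; rewrite /pad ?ilt// leq_max ilt.
by have [|_] := h i; rewrite /pad ?ilt// leq_max ilt orbT.
Qed.

Lemma measurable_cylinder n (B : nat -> set R) :
  (forall i, measurable (B i)) -> measurable (cylinder n B : set (seq_space R)).
Proof. by move=> mB; apply: sub_sigma_algebra; exists n, B. Qed.

Lemma measurable_coordinate i :
  measurable_fun [set: seq_space R] (fun u => u i).
Proof.
move=> _ B mB; rewrite setTI.
rewrite (_ : _ @^-1` _ = cylinder i.+1 (fun j => if j == i then B else setT)).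
  by apply: measurable_cylinder => j; case: ifP.
apply/seteqP; split => [u uB j _|u /(_ i)]; first by case: eqP => // ->.
by rewrite eqxx; exact.
Qed.

Lemma measurable_fun_seq_space d (T : measurableType d) (f : T -> seq_space R) :
  (forall i, measurable_fun [set: T] (fun w => f w i)) ->
  measurable_fun [set: T] f.
Proof.
move=> mf; apply: (@measurability _ _ T (seq_space R) setT f (@cylinders R)) => //.
move=> _ [_ [n [B [mB ->]]] <-]; rewrite setTI.
rewrite (_ : _ @^-1` _ =
    \bigcap_(i in `I_n) (setT `&` (fun w => f w i) @^-1` B i)).
  by apply: bigcap_measurableType => i _; exact: mf.
apply/seteqP; split => [w h i /= ilt|w h i ilt]; first by split => //; exact: h.
by have [] := h i ilt.
Qed.

Definition shift_seq (u : seq_space R) : seq_space R := fun i => u i.+1.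

Lemma measurable_shift_seq : measurable_fun [set: seq_space R] shift_seq.
Proof. by apply: measurable_fun_seq_space => i; exact: measurable_coordinate. Qed.

HB.instance Definition _ := isMeasurableFun.Build _ _ _ _ shift_seq measurable_shift_seq.

End sequence_space.

(** * Walks with i.i.d. steps of negative mean *)

Section iid_walk.
Context d (T : measurableType d) (R : realType) (P : probability T R).
Variable X : nat -> T -> R.
Hypothesis mX : forall i, measurable_fun [set: T] (X i).
Hypothesis iidX : forall n (B : nat -> set R), (forall i, measurable (B i)) ->
  P (\bigcap_(i in `I_n) X i @^-1` B i) = (\prod_(i < n) P (X 0%N @^-1` B i))%E.

(** [T] carries no shift, so the steps are studied through their joint law on sequences, where the
    shift acts. *)
Let Phi (w : T) : seq_space R := fun i => X i w.

Let mPhi : measurable_fun [set: T] Phi.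
Proof. exact: measurable_fun_seq_space. Qed.

HB.instance Definition _ := isMeasurableFun.Build _ _ _ _ Phi mPhi.

Let mu : probability (seq_space R) R := distribution P Phi.

Let mu_cylinder n B : (forall i, measurable (B i)) ->
  mu (cylinder n B) = (\prod_(i < n) P (X 0%N @^-1` B i))%E.
Proof. by move=> mB; rewrite -iidX. Qed.

Let mu_shift C : measurable C -> mu (@shift_seq R @^-1` C) = mu C.
Proof.
move=> mC; suff h : distribution mu (@shift_seq R) C = mu C by exact: h.
have cm : @cylinders R `<=` (measurable : set (set (seq_space R))).
  by move=> A cA; exact: sub_sigma_algebra.
apply: (@g_sigma_algebra_measure_unique _ R (seq_space R) (@cylinders R) cm
  (fun=> setT) _ _ (distribution mu (@shift_seq R)) mu) => //.
- by move=> _; exact: cylindersT.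
- by rewrite bigcup_const//; exists 0%N.
- exact: setI_closed_cylinders.
- move=> _ [n [B [mB ->]]].
  (* The preimage under the shift is a longer box, free in coordinate [0]. *)
  pose B' i := if i is j.+1 then B j else setT.
  have h : mu (shift_seq (R:=R) @^-1` cylinder n B) = mu (cylinder n B).
    rewrite (_ : _ @^-1` _ = cylinder n.+1 B').
      rewrite !mu_cylinder//; last by case=> [|i] //=; exact: mB.
      by rewrite big_ord_recl/= preimage_setT probability_setT mul1e.
    apply/seteqP; split => [u h [|i]//|u h i]; first exact: h.
    exact: (h i.+1).
  by rewrite -[RHS]h.
- by move=> _; rewrite ltey_eq fin_num_measure.
Qed.

(** Preimages of cylinders under the shift form a pi-system generating the events of the later
    coordinates. On them, intersecting with the constraint [D] on coordinate [0] gives a box, whose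
    probability factorises. *)
Let mu_indep A D : measurable A -> measurable D ->
  mu (@shift_seq R @^-1` A `&` (fun u => u 0%N) @^-1` D) =
  (mu A * mu ((fun u => u 0%N) @^-1` D))%E.
Proof.
move=> mA mD; rewrite -(mu_shift mA).
pose G := preimage_set_system setT (@shift_seq R) (@cylinders R).
have mG C : measurable C -> measurable (@shift_seq R @^-1` C).
  by move=> mC; rewrite -[X in measurable X]setTI; exact: measurable_shift_seq.
apply: (@g_sigma_algebra_indep _ _ _ mu G).
- by move=> _ [C cC <-]; rewrite setTI; apply: mG; exact: sub_sigma_algebra.
- by exists setT; [exact: cylindersT|rewrite preimage_setT setTI].
- move=> _ _ [C cC <-] [C' cC' <-]; exists (C `&` C').
    exact: setI_closed_cylinders.
  by rewrite !setTI.
- by rewrite -[X in measurable X]setTI; exact: measurable_coordinate.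
- move=> _ [_ [n [B [mB ->]]] <-].
  rewrite setTI mu_shift; last exact: measurable_cylinder.
  pose B' i := if i is j.+1 then B j else D.
  rewrite (_ : _ `&` _ = cylinder n.+1 B').
    rewrite !mu_cylinder//; last by case=> [|i] //=; exact: mB.
    by rewrite big_ord_recl/= muleC.
  apply/seteqP; split => [u [h uD] [|i]//|u h].
    exact: h.
  split; last exact: (h 0%N).
  by move=> i ilt; exact: (h i.+1).
- by rewrite g_sigma_preimageE; exists A => //; rewrite setTI.
Qed.

Lemma iid_walk_bounded :
  P.-integrable [set: T] (EFin \o X 0%N) -> (\int[P]_w (X 0%N w)%:E < 0)%E ->
  {ae P, forall w, exists K : nat, forall n, \sum_(i < n) X i w <= K%:R}.
Proof.
move=> iX EX.
pose Y (u : seq_space R) := u 0%N.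
have mY : measurable_fun setT Y by exact: measurable_coordinate.
have intY : mu.-integrable setT (EFin \o Y).
  apply: integrable_pushforward => //.
  exact/measurable_EFinP.
have EY : (\int[mu]_u (Y u)%:E < 0)%E.
  by rewrite integral_distribution//; exact/measurable_EFinP.
have := unbounded_walk_null mu_shift intY EY mu_indep.
move=> h; exists (Phi @^-1` unbounded_walk (@shift_seq R) Y); split => //.
  rewrite -[X in measurable X]setTI; apply: mPhi => //.
  exact: (@measurable_unbounded_walk _ _ _ mu).
move=> w /= H K; apply: contra_notP H => H; exists K => n.
rewrite leNgt; apply/negP => Kn; apply: H; exists n.
apply: lt_le_trans Kn _.
have : forall u : seq_space R, \sum_(i < n) u i <= walk_max (@shift_seq R) Y n u.
  elim: n => [|n IH] u; first by rewrite big_ord0.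
  rewrite big_ord_recl /= le_max lerD2l; apply/orP; right.
  exact: IH (shift_seq u).
exact.
Qed.

End iid_walk.

(** * Local boundedness of cadlag paths and their approximation at dyadic times *)

(** Right continuity bounds the path just after [t], and the left limit bounds it just before. *)
Lemma cadlag_near_bounded (R : realType) (x : R -> R) (t : R) :
  cadlag x -> 0 <= t -> exists M, \forall s \near t, 0 <= s -> `|x s| <= M.
Proof.
move=> [xr xl] t0.
have hr : \forall s \near t^'+, `|x s| <= `|x t| + 1.
  by apply: (cvgr_norm_le _ (xr t t0)); rewrite ltrDl.
have [C hl] : exists C, \forall s \near t^'-, 0 <= s -> `|x s| <= C.
  have [t_gt0|t_le0] := ltP 0 t.
    exists (`|lim (x s @[s --> t^'-])| + 1).
    have : \forall s \near t^'-, `|x s| <= `|lim (x s @[s --> t^'-])| + 1.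
      by apply: (cvgr_norm_le _ (xl t t_gt0)); rewrite ltrDl.
    by apply: filterS.
  (* To the left of time [0] there is no [s] with [0 <= s], so any constant serves. *)
  exists 0; near=> s => s0.
  have : s < t by near: s; exact: nbhs_left_lt.
  by move=> /lt_le_trans /(_ t_le0); rewrite ltNge s0.
exists (`|x t| + 1 + `|C|); near=> s => s0.
have h1 : t < s -> `|x s| <= `|x t| + 1 by near: s; exact: hr.
have h2 : s < t -> 0 <= s -> `|x s| <= C by near: s; exact: hl.
have := normr_ge0 C; have := ler_norm C; have := normr_ge0 (x t).
have [st|ts|->] := ltgtP s t.
- by have := h2 st s0; lra.
- by have := h1 ts; lra.
- lra.
Unshelve. all: by end_near. Qed.

(** Compactness of [[0, u]] makes the local bounds uniform; the integer bound is the parameter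
    tending to infinity in the near-covering property. *)
Lemma cadlag_bounded (R : realType) (x : R -> R) (u : R) :
  cadlag x -> exists n : nat, forall t, 0 <= t <= u -> `|x t| <= n%:R.
Proof.
move=> cx.
have : compact `[0, u]%classic by exact: segment_compact.
move=> /compact_near_coveringP /near_covering_withinP.
move=> /(_ nat \oo (fun n s => `|x s| <= n%:R) _) [].
  move=> s /= /[!in_itv]/= /andP[s0 _].
  have [M hM] := cadlag_near_bounded cx s0.
  exists ([set s | 0 <= s -> `|x s| <= M], [set n | M <= n%:R]) => /=.
    by split => //; exact: nbhs_infty_ger.
  by move=> [r n] /= [hr Mn]; rewrite in_itv/= => /andP[r0 _]; exact: le_trans (hr r0) Mn.
by move=> n _ /(_ n (leqnn n)) h; exists n => t tu; apply: h; rewrite /= in_itv.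
Qed.

Section dyadic.
Context (R : realType).

Definition dyadic (k j : nat) : R := j%:R / 2 ^+ k.

(* Strictly above [t], so that only the right limit at [t] matters. *)
Definition dyadic_above (k : nat) (t : R) : R := dyadic k (Num.truncn (t * 2 ^+ k)).+1.

Lemma dyadic_ge0 k j : 0 <= dyadic k j.
Proof. by rewrite divr_ge0. Qed.

Lemma dyadic0 k : dyadic k 0 = 0.
Proof. by rewrite /dyadic mul0r. Qed.

Lemma dyadic_le k i j : (i <= j)%N -> dyadic k i <= dyadic k j.
Proof. by move=> ij; rewrite ler_pM2r ?invr_gt0 ?exprn_gt0// ler_nat. Qed.

Lemma dyadicS k j : dyadic k.+1 j.*2 = dyadic k j.
Proof.
rewrite /dyadic -muln2 natrM exprS; field.
by rewrite expf_neq0// pnatr_eq0.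
Qed.

Lemma dyadic_above_itv k t : 0 <= t ->
  t < dyadic_above k t <= t + (2 ^+ k)^-1.
Proof.
move=> t0; have p0 : 0 < 2 ^+ k :> R by rewrite exprn_gt0.
have /truncn_itv/andP[h1 h2] : 0 <= t * 2 ^+ k by rewrite mulr_ge0// ltW.
rewrite /dyadic_above /dyadic ltr_pdivlMr// h2/= ler_pdivrMr// mulrDl mulVf ?gt_eqF//.
by rewrite -natr1 lerD2r.
Qed.

Lemma dyadic_above_cvg (x : R -> R) t : cadlag x -> 0 <= t ->
  x (dyadic_above k t) @[k --> \oo] --> x t.
Proof.
move=> [xr _] t0.
have h : dyadic_above k t @[k --> \oo] --> t^'+.
  move=> A [e /= e0 eA].
  have : (2^-1) ^+ k @[k --> \oo] --> (0 : R).
    by apply: cvg_expr; rewrite ger0_norm ?invr_ge0// invf_lt1// ltr1n.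
  move=> /cvgrPdist_lt/(_ e e0); apply: filterS => k.
  rewrite sub0r normrN ger0_norm ?exprn_ge0 ?invr_ge0// exprVn => hk.
  have /andP[h1 h2] := dyadic_above_itv k t0.
  apply: (eA _ _ h1) => /=.
  by rewrite ltr0_norm ?subr_lt0//; lra.
exact: (cvg_comp _ _ h (xr t t0)).
Qed.

End dyadic.

(** * Ottaviani's inequality *)

Lemma nonincreasing_null_small d (T : measurableType d) (R : realType)
    (P : probability T R) (F : nat -> set T) (e : R) :
  (forall n, measurable (F n)) -> (forall n, F n.+1 `<=` F n) ->
  P (\bigcap_n F n) = 0%E -> 0 < e -> exists n, (P (F n) <= e%:E)%E.
Proof.
move=> mF dF F0 e0.
have : P \o F @ \oo --> P (\bigcap_n F n).
  apply: nonincreasing_cvg_mu => //.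
  - by rewrite ltey_eq fin_num_measure.
  - exact: bigcapT_measurable.
  - by apply/nonincreasing_seqP => n; apply/subsetPset.
rewrite F0 => /fine_cvgP[_ /cvgrPdist_le /(_ e e0)[n _ /(_ n (leqnn n))]] /=.
rewrite sub0r normrN ger0_norm ?fine_ge0// => h; exists n.
by rewrite -[P (F n)]fineK ?fin_num_measure// lee_fin.
Qed.

Section ottaviani.
Context d (T : measurableType d) (R : realType) (P : probability T R).
(** In the application [S j] is the process at the [j]-th dyadic time and [V j] its value at the
    next integer time. *)
Variables (S V : nat -> T -> R) (a b : R).
Hypothesis mS : forall j, measurable_fun [set: T] (S j).
Hypothesis mV : forall j, measurable_fun [set: T] (V j).
Hypothesis S0 : forall w, S 0%N w = 0.

Let past j (B : nat -> set R) :=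
  \bigcap_(i in `I_j) (fun w => S i.+1 w - S i w) @^-1` B i.

Hypothesis indepS : forall j (B : nat -> set R) C,
  (forall i, measurable (B i)) -> measurable C ->
  P (past j B `&` (fun w => V j w - S j w) @^-1` C) =
  (P (past j B) * P ((fun w => (V j w - S j w)%R) @^-1` C))%E.

Hypothesis tight : forall j, (P [set w | (V j w - S j w < - b)%R] <= (2^-1)%:E)%E.

Let first j := [set w | (a + b < S j w)%R /\ forall i, (i < j)%N -> S i w <= a + b].

Let pasts j := [set E | exists2 B : nat -> set R, (forall i, measurable (B i)) & E = past j B].

Let measurable_past j B : (forall i, measurable (B i)) -> measurable (past j B).
Proof.
move=> mB; apply: bigcap_measurableType => i _.
by rewrite -[X in measurable X]setTI; apply: measurable_funB.
Qed.

(** Since [S] starts at [0], each [S i] with [i <= j] is a sum of the increments generating the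
    past. Hence the first passage at [j] is an event of the past, to which independence extends. *)
Let sigma_first j : <<s pasts j >> (first j).
Proof.
pose T' := g_sigma_algebraType (pasts j).
have mincr i : (i < j)%N -> measurable_fun [set: T'] (fun w => S i.+1 w - S i w).
  move=> ij _ B mB; rewrite setTI; apply: sub_sigma_algebra.
  exists (fun k => if k == i then B else setT); first by move=> k; case: ifP.
  apply/seteqP; split => [w /= Bw k kj|w /= /(_ i ij)].
    by rewrite /=; case: eqP => // ->.
  by rewrite /= eqxx.
have mS' i : (i <= j)%N -> measurable_fun [set: T'] (S i : T' -> R).
  elim: i => [|i IH] ij.
    by rewrite (_ : S 0%N = cst 0); [exact: measurable_cst|apply/funext].
  rewrite (_ : S i.+1 = (fun w => S i w + (S i.+1 w - S i w))).
    by apply: measurable_funD; [exact: IH (ltnW ij)|exact: mincr].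
  by apply/funext => w; rewrite addrC subrK.
have -> : first j = (S j : T' -> R) @^-1` `]a + b, +oo[ `&`
    \bigcap_(i in `I_j) (S i : T' -> R) @^-1` `]-oo, a + b].
  apply/seteqP; split => w /=.
    by move=> [h1 h2]; rewrite in_itv/= andbT; split=> // i /= /h2; rewrite in_itv.
  rewrite in_itv/= andbT => -[h1 h2]; split=> // i /h2.
suff h : measurable ((S j : T' -> R) @^-1` `]a + b, +oo[ `&`
    \bigcap_(i in `I_j) (S i : T' -> R) @^-1` `]-oo, a + b] : set T') by exact: h.
apply: measurableI.
  by rewrite -[X in measurable X]setTI; apply: mS'.
apply: bigcap_measurableType => i /= ij.
by rewrite -[X in measurable X]setTI; apply: mS' => //; exact: ltnW.
Qed.

Let stay j := (fun w => V j w - S j w) @^-1` `[- b, +oo[.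

Let measurable_stay j : measurable (stay j).
Proof. by rewrite -[X in measurable X]setTI; apply: measurable_funB. Qed.

Let pasts_measurable j : pasts j `<=` measurable.
Proof. by move=> _ [B mB ->]; exact: measurable_past. Qed.

Let measurable_first j : measurable (first j).
Proof.
have h := smallest_sub (@sigma_algebra_measurable _ T) (@pasts_measurable j).
exact: h (@sigma_first j).
Qed.

Let first_stay j : P (first j `&` stay j) = (P (first j) * P (stay j))%E.
Proof.
apply: (@g_sigma_algebra_indep _ _ _ P (pasts j)) => //.
- exists (fun=> setT) => //; rewrite /past.
  by rewrite bigcapT.
- move=> _ _ [B mB ->] [C mC ->]; exists (fun i => B i `&` C i).
    by move=> i; exact: measurableI.
  by rewrite /past -bigcapI.
- by move=> _ [B mB ->]; exact: indepS.
Qed.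

Let stay_ge j : ((2^-1)%:E <= P (stay j))%E.
Proof.
rewrite (_ : stay j = ~` [set w | (V j w - S j w < - b)%R]); last first.
  apply/seteqP; split => w; rewrite /stay /= in_itv/= andbT => h.
    by apply/negP; rewrite -leNgt.
  by rewrite leNgt; apply/negP.
have mm : measurable [set w | (V j w - S j w < - b)%R].
  rewrite (_ : [set _ | _] = ~` stay j); first exact: measurableC.
  apply/seteqP; split => w; rewrite /stay /= in_itv/= andbT => h.
    by apply/negP; rewrite -ltNge.
  by rewrite ltNge; apply/negP.
rewrite probability_setC//.
have := tight j; rewrite -[P _]fineK ?fin_num_measure// -EFinB !lee_fin.
lra.
Qed.

(** Split according to the first index [j] where [S] exceeds [a + b]. Independently of this event,
    [V j - S j >= - b] has probability at least one half, and then [V j > a]; at least half of the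
    mass of each disjoint piece is therefore kept. *)
Lemma ottaviani :
  (P (\bigcup_j [set w | (a + b < S j w)%R]) <=
   2%:E * P (\bigcup_j [set w | (a < V j w)%R]))%E.
Proof.
have tfirst : trivIset setT first.
  apply/trivIsetP => i j _ _; wlog ij : i j / (i < j)%N.
    by move=> h; rewrite neq_ltn => /orP[] ij; [|rewrite setIC]; apply: h => //; rewrite neq_ltn ij.
  move=> _; apply/seteqP; split => // w [[h1 _] [_ /(_ _ ij)]].
  by rewrite leNgt h1.
have -> : \bigcup_j [set w | (a + b < S j w)%R] = \bigcup_j first j.
  apply/seteqP; split => w [j _ /= h]; last by exists j => //; have [] := h.
  have ex : exists j, (a + b < S j w)%R by exists j.
  exists (ex_minn ex) => //; case: ex_minnP => m hm mmin; split => // i im.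
  by rewrite leNgt; apply/negP => /mmin; rewrite leqNgt im.
rewrite measure_semi_bigcup//; last exact: bigcupT_measurable.
have mfs j : measurable (first j `&` stay j) by exact: measurableI.
apply: (@le_trans _ _ (\sum_(j <oo) 2%:E * P (first j `&` stay j))%E).
  apply: lee_nneseries => // j _; rewrite first_stay muleCA.
  rewrite -[leLHS]mule1; apply: lee_pmul => //.
  have := stay_ge j; rewrite -[P (stay j)]fineK ?fin_num_measure// -EFinM !lee_fin.
  lra.
rewrite nneseriesZl//; apply: lee_wpmul2l => //.
rewrite -measure_semi_bigcup//; last 2 first.
- apply/trivIsetP => i j _ _ ij.
  move/trivIsetP : tfirst => /(_ i j I I ij) fij.
  by apply/seteqP; split => // w [[f1 _] [f2 _]]; rewrite -[set0]fij.
- exact: bigcupT_measurable.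
apply: le_measure; rewrite ?inE.
- exact: bigcupT_measurable.
- apply: bigcupT_measurable => j.
  rewrite (_ : [set _ | _] = V j @^-1` `]a, +oo[).
    by rewrite -[X in measurable X]setTI; apply: mV.
  by apply/seteqP; split => w /=; rewrite in_itv/= andbT.
move=> w [j _ [[h1 _]]]; rewrite /stay /= in_itv/= andbT => h2.
by exists j => //=; lra.
Qed.

End ottaviani.

(** * Levy processes of negative mean are bounded above *)

Lemma ae_eq_integrable d (T : measurableType d) (R : realType)
    (mu : {measure set T -> \bar R}) (f g : T -> \bar R) :
  measurable_fun [set: T] g -> {ae mu, forall w, f w = g w} ->
  mu.-integrable [set: T] f -> mu.-integrable [set: T] g.
Proof.
move=> mg fg /integrableP[mf intf]; apply/integrableP; split => //.
rewrite (ae_eq_integral (abse \o f))//.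
- exact: measurableT_comp.
- exact: measurableT_comp.
- by apply: filterS fg => w /= -> _.
Qed.

Lemma bigcap_setT_ord T n (F : nat -> set T) :
  \bigcap_(i in [set: 'I_n]) F i = \bigcap_(i in `I_n) F i.
Proof.
apply/seteqP; split => w h i /=; last by move=> _; apply: h => /=.
by move=> ilt; exact: (h (Ordinal ilt) I).
Qed.

Section levy.
Context d (T : measurableType d) (R : realType) (P : probability T R).

Lemma levy_indep_past (Z : R -> T -> R) (t : nat -> R) n (B : nat -> set R) :
  levy_process P Z -> 0 <= t 0%N -> (forall i, t i <= t i.+1) ->
  (forall i, measurable (B i)) ->
  let X i w := Z (t i.+1) w - Z (t i) w in
  P (\bigcap_(i in `I_n) X i @^-1` B i) = (\prod_(i < n) P (X i @^-1` B i))%E.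
Proof.
move=> lZ t0 tS mB X; rewrite -bigcap_setT_ord.
exact: (levy_independent lZ t0 tS (B := fun i : 'I_n => B i)).
Qed.

(** Subtracting [xi 0 w] makes the process start from [0] at every [w], where [xi] does so only
    almost surely. *)
Definition drifted (s c : R) (xi : R -> T -> R) (t : R) (w : T) : R :=
  s * (xi t w - xi 0 w) + c * t.

Lemma drifted0 s c xi w : drifted s c xi 0 w = 0.
Proof. by rewrite /drifted subrr !mulr0 addr0. Qed.

(** Each increment is an affine image of the increment of [xi] over the same interval, with a
    constant that depends only on its length; events about increments pull back along this map. *)
Lemma levy_drifted s c xi : levy_process P xi -> levy_process P (drifted s c xi).
Proof.
move=> lxi.
have mxi t : 0 <= t -> measurable_fun [set: T] (drifted s c xi t).
  move=> t0; apply: measurable_funD => //; apply: measurable_funM => //.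
  by apply: measurable_funB; exact: levy_measurable lxi _ _.
have maff u : measurable_fun [set: R] (fun y : R => s * y + c * u).
  by apply: measurable_funD => //; exact: measurable_funM.
have incr u v w : drifted s c xi v w - drifted s c xi u w =
    s * (xi v w - xi u w) + c * (v - u) by rewrite /drifted; ring.
have maffB u B : measurable B -> measurable ((fun y : R => s * y + c * u) @^-1` B).
  by move=> mB; rewrite -[X in measurable X]setTI; exact: maff.
split=> //.
- by apply: aeW => w; exact: drifted0.
- apply: filterS (levy_cadlag lxi) => w [xr xl]; split => t t0.
    apply: cvgD; last by apply: cvgMr; exact: cvg_at_right_filter.
    by apply: cvgMr; apply: cvgB; [exact: xr|exact: cvg_cst].
  have /cvg_ex[l hl] := xl t t0; apply/cvg_ex; exists (s * (l - xi 0 w) + c * t).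
  apply: cvgD; last by apply: cvgMr; exact: cvg_at_left_filter.
  by apply: cvgMr; apply: cvgB; [exact: hl|exact: cvg_cst].
- move=> n t t0 tS B mB.
  have := levy_independent lxi t0 tS (fun i => maffB (t i.+1 - t i) _ (mB i)).
  have inc (i : 'I_n) : (fun w => xi (t i.+1) w - xi (t i) w) @^-1`
     ((fun y : R => s * y + c * (t i.+1 - t i)) @^-1` B i) =
     (fun w => drifted s c xi (t i.+1) w - drifted s c xi (t i) w) @^-1` B i.
    by apply/seteqP; split => w /=; rewrite incr.
  by under eq_bigcapr do rewrite inc; under eq_bigr do rewrite inc.
- move=> u v u0 v0 B mB.
  have incB w0 : 0 <= w0 -> (fun w => drifted s c xi (w0 + v) w - drifted s c xi w0 w) @^-1` B =
     (fun w => xi (w0 + v) w - xi w0 w) @^-1` ((fun y : R => s * y + c * v) @^-1` B).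
    by move=> _; apply/seteqP; split => w /=; rewrite incr addrAC subrr add0r.
  rewrite incB// (levy_stationary lxi u0 v0 (maffB v B mB)).
  (* The law at time [v] is treated as that of the increment from [0] to [v], because [drifted]
     vanishes at [0]. *)
  rewrite -(levy_stationary lxi (lexx 0) v0 (maffB v B mB)) -incB// add0r.
  congr (P _); apply/seteqP; split => w /=; by rewrite drifted0 subr0.
Qed.

Variable Z : R -> T -> R.
Hypothesis levyZ : levy_process P Z.
Hypothesis Z0 : forall w, Z 0 w = 0.

Let mZ t : 0 <= t -> measurable_fun [set: T] (Z t).
Proof. exact: levy_measurable levyZ _. Qed.

Let measurable_gt t a : 0 <= t -> measurable [set w | a < Z t w].
Proof.
move=> t0; rewrite (_ : [set _ | _] = Z t @^-1` `]a, +oo[).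
  by rewrite -[X in measurable X]setTI; apply: mZ.
by apply/seteqP; split => w /=; rewrite in_itv/= andbT.
Qed.

Let measurable_lt t a : 0 <= t -> measurable [set w | Z t w < a].
Proof.
move=> t0; rewrite (_ : [set _ | _] = Z t @^-1` `]-oo, a[).
  by rewrite -[X in measurable X]setTI; apply: mZ.
by apply/seteqP; split => w /=; rewrite in_itv.
Qed.

Lemma levy_skeleton_bounded :
  P.-integrable [set: T] (EFin \o Z 1) -> (\int[P]_w (Z 1 w)%:E < 0)%E ->
  {ae P, forall w, exists K : nat, forall n, Z n%:R w <= K%:R}.
Proof.
move=> intZ EZ.
pose X i w := Z i.+1%:R w - Z i%:R w.
have X0 : X 0%N = Z 1 by apply/funext => w; rewrite /X Z0 subr0.
have lawX i B : measurable B -> P (X i @^-1` B) = P (X 0%N @^-1` B).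
  move=> mB; rewrite X0 -(levy_stationary levyZ (ler0n _ i) ler01 mB).
  by rewrite /X natr1.
have mX i : measurable_fun [set: T] (X i).
  by apply: measurable_funB; exact: mZ.
have iidX n (B : nat -> set R) : (forall i, measurable (B i)) ->
    P (\bigcap_(i in `I_n) X i @^-1` B i) = (\prod_(i < n) P (X 0%N @^-1` B i))%E.
  move=> mB; rewrite (levy_indep_past (t := fun i => i%:R) _ levyZ)//.
    by apply: eq_bigr => i _; exact: lawX.
  by move=> i; rewrite ler_nat.
have := iid_walk_bounded mX iidX; rewrite X0 => /(_ intZ EZ).
apply: filterS => w [K hK]; exists K => n.
have <- : \sum_(i < n) X i w = Z n%:R w; last exact: hK.
elim: n => [|n IH]; first by rewrite big_ord0 Z0.
by rewrite big_ord_recr/= IH /X addrC subrK.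
Qed.

(** One [b] serves all meshes: a cadlag path is bounded on [[0, 1]], so the events that some dyadic
    value there falls below [- n] decrease to a null event. *)
Lemma levy_tight : exists b : nat, forall k j, (j <= 2 ^ k)%N ->
  (P [set w | (Z (dyadic R k j) w < - b%:R)%R] <= (2^-1)%:E)%E.
Proof.
pose F (n : nat) := \bigcup_k \bigcup_(j in [set j | (j <= 2 ^ k)%N])
  [set w | Z (dyadic R k j) w < - n%:R].
have mF n : measurable (F n).
  apply: bigcupT_measurable => k; apply: bigcup_measurable => j _.
  exact/measurable_lt/dyadic_ge0.
have := @nonincreasing_null_small _ _ _ P F 2^-1 mF.
case.
- move=> n w [k _ [j jk /= h]]; exists k => //; exists j => //=.
  by apply: lt_trans h _; rewrite ltrN2 ltr_nat.
- apply/(negligibleP _ (bigcapT_measurable _)) => //.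
  apply: negligibleS (levy_cadlag levyZ) => w Fw /= cw.
  have [n hn] := @cadlag_bounded R (fun t => Z t w) 1 cw.
  have [k _ [j jk /=]] := Fw n I.
  have : 0 <= dyadic R k j <= 1.
    rewrite dyadic_ge0/= /dyadic ler_pdivrMr ?exprn_gt0// mul1r.
    by rewrite -natrX ler_nat.
  move=> /hn; rewrite ler_norml => /andP[+ _].
  by move=> /le_lt_trans /[apply]; rewrite ltxx.
- by rewrite invr_gt0.
- move=> n hn; exists n => k j jk; apply: le_trans hn.
  apply: le_measure; rewrite ?inE//.
    exact/measurable_lt/dyadic_ge0.
  by move=> w h; exists k => //; exists j.
Qed.

(** From a dyadic time to the next integer takes at most one unit, so tightness on [[0, 1]] is
    enough; the right-hand side does not depend on the mesh. *)
Lemma levy_ottaviani (a b : R) k :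
  (forall j, (j <= 2 ^ k)%N ->
    (P [set w | (Z (dyadic R k j) w < - b)%R] <= (2^-1)%:E)%E) ->
  (P (\bigcup_j [set w | (a + b < Z (dyadic R k j) w)%R]) <=
   2%:E * P (\bigcup_n [set w | (a < Z n%:R w)%R]))%E.
Proof.
move=> tight.
(* [c j] is the least integer above the dyadic point [j / 2 ^ k], at
   distance [r j / 2 ^ k] from it. *)
pose c j := (j %/ 2 ^ k).+1.
pose r j := (2 ^ k - j %% 2 ^ k)%N.
have cE j : dyadic R k j + dyadic R k (r j) = (c j)%:R.
  rewrite /dyadic -mulrDl -natrD -natrX.
  have -> : (j + r j = c j * 2 ^ k)%N.
    have := divn_eq j (2 ^ k); have := ltn_mod j (2 ^ k).
    rewrite /r /c; have := expn_gt0 2 k; nia.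
  by rewrite natrM mulfK// pnatr_eq0 -lt0n expn_gt0.
apply: (@le_trans _ _ (2%:E * P (\bigcup_j [set w | (a < Z (c j)%:R w)%R]))%E); last first.
  apply: lee_wpmul2l => //; apply: le_measure; rewrite ?inE.
  - by apply: bigcupT_measurable => j; exact: measurable_gt.
  - by apply: bigcupT_measurable => j; exact: measurable_gt.
  - by move=> w [j _ h]; exists (c j).
apply: (@ottaviani _ _ _ P (fun j => Z (dyadic R k j)) (fun j => Z (c j)%:R)) => //.
- by move=> j; apply: mZ; exact: dyadic_ge0.
- by move=> j; exact: mZ.
- by move=> w; rewrite dyadic0.
- move=> j B C mB mC.
  (* One sequence of times, dyadic up to index [j] and equal to [c j] afterwards, puts the past
     increments and the last one into a single independent family. *)
  pose t i := if (i <= j)%N then dyadic R k i else (c j)%:R.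
  pose B' i := if (i < j)%N then B i else C.
  have mB' i : measurable (B' i) by rewrite /B'; case: ifP.
  have t0 : 0 <= t 0%N by rewrite /t /= dyadic_ge0.
  have tS i : t i <= t i.+1.
    rewrite /t; case: (ltngtP i j) => ij; rewrite ?(ltnW ij)//.
      exact: dyadic_le.
    by rewrite ij -cE lerDl dyadic_ge0.
  pose X i w := Z (t i.+1) w - Z (t i) w.
  have XB i : (i < j)%N -> X i @^-1` B' i =
      (fun w => Z (dyadic R k i.+1) w - Z (dyadic R k i) w) @^-1` B i.
    by move=> ij; rewrite /X /B' /t ij (ltnW ij).
  have XC : X j @^-1` B' j = (fun w => Z (c j)%:R w - Z (dyadic R k j) w) @^-1` C.
    by rewrite /X /B' /t ltnn leqnn.
  have pastE : \bigcap_(i in `I_j)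
      (fun w => Z (dyadic R k i.+1) w - Z (dyadic R k i) w) @^-1` B i =
      \bigcap_(i in `I_j) X i @^-1` B' i.
    by apply: eq_bigcapr => i /= ij; rewrite XB.
  have indX n : P (\bigcap_(i in `I_n) X i @^-1` B' i) =
      (\prod_(i < n) P (X i @^-1` B' i))%E by exact: levy_indep_past.
  have recX : \bigcap_(i in `I_j) X i @^-1` B' i `&` X j @^-1` B' j =
      \bigcap_(i in `I_j.+1) X i @^-1` B' i by rewrite IIS bigcap_setU bigcap_set1.
  by rewrite pastE -XC recX indX big_ord_recr/= -indX.
- move=> j; rewrite (_ : [set _ | _] =
    (fun w => Z (dyadic R k j + dyadic R k (r j)) w - Z (dyadic R k j) w)
      @^-1` `]-oo, - b[); last first.
    by rewrite cE; apply/seteqP; split => w /=; rewrite in_itv.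
  (* The remaining increment has the law of [Z] at the dyadic time [r j / 2 ^ k], which lies in
     [[0, 1]]. *)
  rewrite (levy_stationary levyZ)//; [|exact: dyadic_ge0..].
  have := tight (r j) (leq_subr _ _).
  rewrite (_ : [set _ | _] = Z (dyadic R k (r j)) @^-1` `]-oo, - b[)//.
Qed.

Lemma levy_bounded_above :
  P.-integrable [set: T] (EFin \o Z 1) -> (\int[P]_w (Z 1 w)%:E < 0)%E ->
  {ae P, forall w, exists K, forall t, 0 <= t -> Z t w <= K}.
Proof.
move=> intZ EZ.
have [b hb] := levy_tight.
pose J (n : nat) := \bigcup_m [set w | n%:R < Z m%:R w].
have mJ n : measurable (J n) by apply: bigcupT_measurable => m; exact: measurable_gt.
have dJ n : J n.+1 `<=` J n.
  by move=> w [m _ /= h]; exists m => //=; apply: lt_trans h; rewrite ltr_nat.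
have J0 : P (\bigcap_n J n) = 0%E.
  apply/(negligibleP _ (bigcapT_measurable _)) => //.
  apply: negligibleS (levy_skeleton_bounded intZ EZ) => w Jw /= [K hK].
  by have [m _ /=] := Jw K I; rewrite ltNge hK.
pose D (n k : nat) := \bigcup_j [set w | n%:R + b%:R < Z (dyadic R k j) w].
have mD n k : measurable (D n k).
  by apply: bigcupT_measurable => j; exact/measurable_gt/dyadic_ge0.
have mD' n : measurable (\bigcup_k D n k) by exact: bigcupT_measurable.
have hD n : (P (\bigcup_k D n k) <= 2%:E * P (J n))%E.
  (* Refining the mesh only enlarges [D n k], so the bound, uniform in [k], passes to the union. *)
  have : P \o D n @ \oo --> P (\bigcup_k D n k).
    apply: nondecreasing_cvg_mu => //.
    apply/nondecreasing_seqP => k; apply/subsetPset => w [j _ /= h].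
    by exists j.*2 => //=; rewrite dyadicS.
  move=> /cvge_to_le; apply; apply: nearW => k /=.
  by apply: levy_ottaviani => j; exact: hb.
have : {ae P, forall w, exists n : nat, forall k j, Z (dyadic R k j) w <= n%:R + b%:R}.
exists (\bigcap_n \bigcup_k D n k); split.
- exact: bigcapT_measurable.
- apply/eqP; rewrite eq_le measure_ge0 andbT.
  apply/lee_addgt0Pr => e e0; rewrite add0e.
  (* The half compensates the factor 2 in Ottaviani's inequality. *)
  have e20 : 0 < e / 2 by rewrite divr_gt0.
  have [n hn] := nonincreasing_null_small mJ dJ J0 e20.
  apply: (@le_trans _ _ (P (\bigcup_k D n k))).
    apply: le_measure; rewrite ?inE//; first exact: bigcapT_measurable.
    exact: bigcap_inf.
  apply: le_trans (hD n) _.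
  by apply: le_trans (lee_wpmul2l _ hn) _ => //; rewrite -EFinM mulrC divfK.
- move=> w /= H; apply: contrapT => notN; apply: H.
  have [n nD] : exists n, ~ (\bigcup_k D n k) w.
    by apply/existsNP => allD; apply: notN => n _.
  exists n => k j; rewrite leNgt; apply/negP => h.
  by apply: nD; exists k => //; exists j.
move=> bd; apply: filterS2 bd (levy_cadlag levyZ) => w [n hn] cw.
exists (n%:R + b%:R) => t t0.
have := dyadic_above_cvg cw t0.
by move=> /cvgr_to_le; apply; apply: nearW => k; exact: hn.
Qed.

End levy.

(** * Linear growth of the Levy process *)

Section growth.
Context d (T : measurableType d) (R : realType) (P : probability T R).
Variable xi : R -> T -> R.
Hypothesis levyxi : levy_process P xi.
Hypothesis intxi : P.-integrable [set: T] (EFin \o xi 1).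
Let mu := fine (\int[P]_w (xi 1 w)%:E)%E.

(** The quantity [s * mu + c] is the mean of [drifted s c xi] at time [1]. The signs [s = 1] and
    [s = - 1] will give the upper and lower bounds on [xi]. *)
Lemma levy_drift_bounded s c : s * mu + c < 0 ->
  {ae P, forall w, exists K, forall t, 0 <= t -> s * xi t w + c * t <= K}.
Proof.
move=> smuc.
have lZ := levy_drifted s c levyxi.
have start w : xi 0 w = 0 -> (s%:E * (xi 1 w)%:E + c%:E = (drifted s c xi 1 w)%:E)%E.
  by move=> x0; rewrite /drifted x0 subr0 mulr1.
have iaff : P.-integrable setT (fun w => s%:E * (xi 1 w)%:E + c%:E)%E.
  apply: integrableD => //; first exact: (integrableZl measurableT s intxi).
  exact: finite_measure_integrable_cst.
have mZ1 : measurable_fun setT (EFin \o drifted s c xi 1).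
  by apply/measurable_EFinP; exact: levy_measurable lZ _ ler01.
have iZ : P.-integrable setT (EFin \o drifted s c xi 1).
  apply: ae_eq_integrable iaff => //.
  by apply: filterS (levy_start0 levyxi) => w /start.
have EZ : (\int[P]_w (drifted s c xi 1 w)%:E < 0)%E.
  rewrite (ae_eq_integral (fun w => s%:E * (xi 1 w)%:E + c%:E)%E)//; last 2 first.
  - exact: measurable_int iaff.
  - by apply: filterS (levy_start0 levyxi) => w /start.
  rewrite integralD//; last 2 first.
  - exact: (integrableZl measurableT s intxi).
  - exact: finite_measure_integrable_cst.
  rewrite integralZl// integral_cst//.
  rewrite [X in (c%:E * X)%E](probability_setT P) mule1.
  by rewrite -[integral _ _ _]fineK ?integrable_fin_num// -EFinM -EFinD lte_fin.
have := levy_bounded_above lZ (drifted0 s c xi) iZ EZ.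
apply: filterS2 (levy_start0 levyxi) => w x0 [K hK]; exists K => t t0.
by have := hK t t0; rewrite /drifted x0 subr0.
Qed.

(** The law of large numbers [x t / t -> m] together with local boundedness, as one affine bound
    valid from time [0]. *)
Definition linear_growth (m : R) (x : R -> R) :=
  forall e, 0 < e -> exists K, forall t, 0 <= t -> `|x t - m * t| <= K + e * t.

Lemma levy_linear_growth : {ae P, forall w, linear_growth mu (fun t => xi t w)}.
Proof.
(* Errors of the form [1 / (n + 1)] suffice and involve only countably many null sets. *)
have : {ae P, forall w, forall n : nat,
  (exists K, forall t, 0 <= t -> 1 * xi t w + (- mu - n.+1%:R^-1) * t <= K) /\
  (exists K, forall t, 0 <= t -> - 1 * xi t w + (mu - n.+1%:R^-1) * t <= K)}.
  apply: ae_foralln => n.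
  have n0 : 0 < n.+1%:R^-1 :> R by rewrite invr_gt0.
  have h1 : 1 * mu + (- mu - n.+1%:R^-1) < 0 by rewrite mul1r addrA subrr add0r oppr_lt0.
  have h2 : -1 * mu + (mu - n.+1%:R^-1) < 0 by rewrite mulN1r addrA addNr add0r oppr_lt0.
  apply: filterS2 (levy_drift_bounded h1) (levy_drift_bounded h2) => w.
  by move=> ? ?; split.
apply: filterS => w h e e0.
have ne : (Num.truncn e^-1).+1%:R^-1 <= e.
  rewrite invf_ple ?posrE//; apply/ltW; exact: real_truncnS_gt (num_real _).
have [[K1 h1] [K2 h2]] := h (Num.truncn e^-1).
exists (`|K1| + `|K2|) => t t0.
have := h1 t t0; have := h2 t t0.
have := ler_wpM2r t0 ne.
have := ler_norm K1; have := ler_norm K2; have := normr_ge0 K1; have := normr_ge0 K2.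
move: (_.+1%:R^-1) => f ? ? ? ? ? ? ?; rewrite ler_norml; apply/andP; split; lra.
Qed.

End growth.

(** * Joint measurability of cadlag families *)

Section cadlag_measurability.
Context (R : realType).

(* By right continuity [f t p] is the limit of the values of [f] at the dyadic
   times above [t].  Times are clamped at [0] because negative ones are
   unconstrained. *)
Lemma measurable_cadlag_family d (S : measurableType d) (f : R -> S -> R) :
  (forall t, 0 <= t -> measurable_fun [set: S] (f t)) ->
  (forall p, cadlag (f ^~ p)) ->
  measurable_fun [set: S * R] (fun q => f (Num.max 0 q.2) q.1).
Proof.
move=> mf cf.
pose g k (q : S * R) := f (dyadic_above k (Num.max 0 q.2)) q.1.
apply: (@measurable_fun_cvg _ _ _ _ g); last first.
  by move=> q _; apply: (dyadic_above_cvg (cf q.1)); rewrite le_max lexx.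
move=> k _ B mB; rewrite setTI.
pose h (r : R) := Num.max 0 r * 2 ^+ k.
have mh : measurable_fun [set: R] h.
  by apply: measurable_funM => //; exact: measurable_maxr.
(* Where [h] lies between [j] and [j + 1], the dyadic time above is the constant [(j + 1) / 2 ^ k];
   these countably many slabs cover everything. *)
have -> : g k @^-1` B = \bigcup_j
    ((h \o snd) @^-1` `[j%:R, j.+1%:R[ `&` (f (dyadic R k j.+1) \o fst) @^-1` B).
  have h0 r : 0 <= h r by rewrite mulr_ge0 ?exprn_ge0// le_max lexx.
  apply/seteqP; split => [[p r] /= Bg|[p r] [j _ /= [jh Bf]]].
    by exists (Num.truncn (h r)) => //=; rewrite in_itv/= truncn_itv.
  rewrite /g /dyadic_above; move: jh; rewrite in_itv/= => jh.
  by rewrite -/(h r) (truncn_def jh).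
apply: bigcupT_measurable => j; apply: measurableI.
  have mhs : measurable_fun [set: S * R] (h \o snd).
    exact: measurableT_comp mh measurable_snd.
  by rewrite -[X in measurable X]setTI; exact: mhs.
have mff : measurable_fun [set: S * R] (f (dyadic R k j.+1) \o fst).
  exact: measurableT_comp (mf _ (dyadic_ge0 _ _ _)) measurable_fst.
by rewrite -[X in measurable X]setTI; exact: mff.
Qed.

Lemma measurable_cadlag (x : R -> R) : cadlag x ->
  measurable_fun [set: R] (fun t => x (Num.max 0 t)).
Proof.
move=> cx.
have := @measurable_cadlag_family _ unit (fun t _ => x t) (fun _ _ => measurable_cst _) (fun=> cx).
by move=> mx; exact: measurableT_comp mx (pair1_measurable tt).
Qed.

End cadlag_measurability.

(** * The exponential functional as a real function *)

Section exp_functional.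
Context (R : realType) (x : R -> R).
Hypothesis cx : cadlag x.

Let g (s : R) : \bar R := (expR (x (Num.max 0 s)))%:E.

Let mg : measurable_fun [set: R] g.
Proof.
apply/measurable_EFinP; apply: measurableT_comp; last exact: measurable_cadlag.
exact: measurable_expR.
Qed.

Let g0 s : (0 <= g s)%E.
Proof. by rewrite lee_fin expR_ge0. Qed.

Let exp_functionalE u :
  exp_functional x u = (\int[lebesgue_measure]_(s in `[0%R, u]) g s)%E.
Proof.
apply: eq_integral => s; rewrite inE/= in_itv/= => /andP[s0 _].
by rewrite /g max_r.
Qed.

Definition expA (u : R) : R := fine (exp_functional x u).

Lemma exp_functional_fin u : exp_functional x u \is a fin_num.
Proof.
rewrite exp_functionalE.
have [n hn] := cadlag_bounded u cx.
rewrite ge0_fin_numE; last by apply: integral_ge0.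
apply: (@le_lt_trans _ _ (\int[lebesgue_measure]_(s in `[0%R, u]) (expR n%:R)%:E)%E).
  apply: ge0_le_integral => //.
  - exact: measurable_funTS.
  - move=> s /=; rewrite in_itv/= => /andP[s0 su]; rewrite lee_fin ler_expR max_r//.
    by rewrite (le_trans (ler_norm _))// hn// s0.
rewrite integral_cst//= lebesgue_measure_itv/= lte_fin; case: ifP => _.
  by rewrite -EFinB -EFinM ltry.
by rewrite mule0.
Qed.

Lemma exp_functional_expA u : exp_functional x u = (expA u)%:E.
Proof. by rewrite fineK// exp_functional_fin. Qed.

Lemma expA0 : expA 0 = 0.
Proof. by rewrite /expA /exp_functional set_itv1 integral_set1. Qed.

Lemma integral_exp_path_cc u :
  (\int[lebesgue_measure]_(s in `[0%R, u]) (expR (x (Num.max 0 s)))%:E)%E =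
  (expA u)%:E.
Proof. by rewrite -exp_functional_expA exp_functionalE. Qed.

Lemma integral_exp_path_oc u v : 0 <= u <= v ->
  (\int[lebesgue_measure]_(s in `]u, v]) (expR (x (Num.max 0 s)))%:E)%E =
  (expA v - expA u)%:E.
Proof.
move=> /andP[u0 uv]; rewrite EFinB -!integral_exp_path_cc.
rewrite (@itv_bndbnd_setU _ _ (BLeft 0) (BRight u) (BRight v)); last 2 first.
- by rewrite bnd_simp.
- by rewrite bnd_simp.
rewrite ge0_integral_setU//=; last 2 first.
- exact: measurable_funTS.
- rewrite disj_set2E; apply/eqP/seteqP; split => // s /= [].
  rewrite !in_itv/= => /andP[_ su] /andP[us _].
  by move: us; rewrite ltNge su.
by rewrite addeAC subee ?add0e// integral_exp_path_cc.
Qed.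

Lemma expA_incr u v c C : 0 <= u <= v -> 0 <= c ->
  (forall s, u < s <= v -> c <= expR (x s) <= C) ->
  c * (v - u) <= expA v - expA u <= C * (v - u).
Proof.
move=> /[dup] uv' /andP[u0]; rewrite le_eqVlt => /predU1P[<- _ _|uv c0 hb].
  by rewrite !subrr !mulr0 lexx.
have AE := integral_exp_path_oc uv'.
have l_uv : lebesgue_measure (`]u, v] : set R) = (v - u)%:E.
  by rewrite lebesgue_measure_itv/= lte_fin uv.
have uvE s : `]u, v]%classic s -> u < s <= v /\ Num.max 0 s = s.
  rewrite /= in_itv/= => /andP[us sv]; rewrite us sv max_r//.
  exact/ltW/(le_lt_trans u0).
rewrite -!lee_fin -AE !EFinM -l_uv -!integral_cst//; apply/andP; split.
  apply: ge0_le_integral => //; first exact: measurable_funTS.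
  move=> s /uvE[/hb/andP[h _] e]; by rewrite /g e lee_fin.
apply: ge0_le_integral => //; first exact: measurable_funTS.
move=> s /uvE[/hb/andP[_ h] e]; by rewrite /g e lee_fin.
Qed.

Lemma expA_le u v : 0 <= u <= v -> expA u <= expA v.
Proof.
move=> uv; have [n hn] := cadlag_bounded v cx.
have : 0 * (v - u) <= expA v - expA u <= expR n%:R * (v - u).
  apply: expA_incr => // s /andP[us sv]; rewrite expR_ge0 ler_expR/=.
  rewrite (le_trans (ler_norm _))// hn// sv andbT.
  by move: uv => /andP[u0 _]; exact/ltW/(le_lt_trans u0).
by rewrite mul0r subr_ge0 => /andP[].
Qed.

Lemma expA_ge0 u : 0 <= u -> 0 <= expA u.
Proof. by move=> u0; rewrite -expA0 expA_le// lexx. Qed.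

(** The path is bounded on [[0, U]]. This quantitative continuity is what inverting [expA] rests
    on. *)
Lemma expA_lipschitz U : exists2 C, 0 < C &
  forall u v, 0 <= u <= v -> v <= U -> expA v - expA u <= C * (v - u).
Proof.
have [n hn] := cadlag_bounded U cx; exists (expR n%:R) => [|u v uv vU].
  exact: expR_gt0.
have : 0 * (v - u) <= expA v - expA u <= expR n%:R * (v - u).
  apply: expA_incr => // s /andP[us sv]; rewrite expR_ge0 ler_expR/=.
  rewrite (le_trans (ler_norm _))// hn// (le_trans sv vU) andbT.
  by move: uv => /andP[u0 _]; exact/ltW/(le_lt_trans u0).
by move=> /andP[].
Qed.

End exp_functional.

(** * Logarithmic growth of the inverse [tau] *)

(** This is [F t = c ln t + o (ln t)], with [K] both the threshold and the additive error. *)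
Definition loglike (R : realType) (c : R) (F : R -> \bar R) :=
  forall e, 0 < e -> exists K, forall t, K <= t ->
    (((c - e) * ln t - K)%:E <= F t <= ((c + e) * ln t + K)%:E)%E.

Section tau.
Context (R : realType) (x : R -> R).
Hypothesis cx : cadlag x.

Lemma tau_le u t : 0 <= u -> t <= expA x u -> (tau x t <= u%:E)%E.
Proof.
move=> u0 tu; apply: ereal_inf_lbound; exists u => //; split => //.
by rewrite exp_functional_expA// lee_fin.
Qed.

Lemma tau_ge b t : (forall u, 0 <= u -> t <= expA x u -> b <= u) -> (b%:E <= tau x t)%E.
Proof.
move=> h; apply: le_ereal_inf_tmp => _ [u [u0]] + <-.
by rewrite exp_functional_expA// !lee_fin; exact: h.
Qed.

Lemma tau_ge0 t : (0 <= tau x t)%E.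
Proof. exact: tau_ge. Qed.

End tau.

Section growth.
Context (R : realType) (x : R -> R) (m : R).
Hypotheses (cx : cadlag x) (m0 : 0 < m) (gx : linear_growth m x).

(** Keep only the last unit of time: there [x s >= (m - e) s - K] is at least its value at [u - 1],
    as [m - e] is positive. *)
Lemma expA_lower e : 0 < e < m -> exists2 K, 0 <= K &
  forall u, 1 <= u -> expR ((m - e) * (u - 1) - K) <= expA x u.
Proof.
move=> /andP[e0 em]; have [K hK] := gx e0; exists `|K| => // u u1.
have [n hn] := cadlag_bounded u cx.
have u10 : 0 <= u - 1 by rewrite subr_ge0.
have : expR ((m - e) * (u - 1) - `|K|) * (u - (u - 1)) <= expA x u - expA x (u - 1)
    <= expR n%:R * (u - (u - 1)).
  apply: expA_incr => //; first by rewrite u10; lra.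
  move=> s /andP[us su]; have s0 : 0 <= s := ltW (le_lt_trans u10 us).
  rewrite !ler_expR (le_trans (ler_norm (x s)) (hn s _)) ?s0// andbT.
  have := hK s s0; rewrite ler_norml => /andP[h _].
  have : (m - e) * (u - 1) <= (m - e) * s.
    by rewrite ler_pM2l ?subr_gt0// ltW.
  have := ler_norm K; lra.
have := expA_ge0 cx u10.
by rewrite subKr mulr1; lra.
Qed.

(** Half of [e] bounds the path, and the other half absorbs the length [u] of the interval into an
    exponential. *)
Lemma expA_upper e : 0 < e -> exists2 K, 0 <= K &
  forall u, 0 <= u -> expA x u <= expR ((m + e) * u + K).
Proof.
move=> e0; have e20 : 0 < e / 2 by rewrite divr_gt0.
have [K hK] := gx e20; exists (`|K| + `|ln (e / 2)|) => [|u u0].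
  by rewrite addr_ge0.
have : 0 * (u - 0) <= expA x u - expA x 0 <= expR (`|K| + (m + e / 2) * u) * (u - 0).
  apply: expA_incr => //; first by rewrite lexx.
  move=> s /andP[/ltW s0 su]; rewrite expR_ge0 ler_expR/=.
  have := hK s s0; rewrite ler_norml => /andP[_ h].
  have : (m + e / 2) * s <= (m + e / 2) * u by rewrite ler_pM2l// addr_gt0.
  have := ler_norm K; lra.
rewrite expA0// !subr0 => /andP[_ /le_trans]; apply.
have : u <= expR (e / 2 * u + `|ln (e / 2)|).
  apply: (@le_trans _ _ (expR (e / 2 * u - ln (e / 2)))); last first.
    by rewrite ler_expR lerD2l; have := ler_norm (- ln (e / 2)); rewrite normrN.
  rewrite expRD expRN lnK ?posrE// ler_pdivlMr// mulrC.
  by apply: le_trans (expR_ge1Dx _); rewrite lerDr.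
move=> /(ler_wpM2l (expR_ge0 (`|K| + (m + e / 2) * u))) /le_trans; apply.
by rewrite -expRD ler_expR; lra.
Qed.

Lemma expA_unbounded t : exists2 u, 0 <= u & t <= expA x u.
Proof.
have hm := m0; have [|K K0 hK] := @expA_lower (m / 2).
  by lra.
(* At this time the exponent in the lower bound equals [|t|], and [expR |t|] exceeds [t]. *)
exists (1 + (`|t| + K) / (m - m / 2)).
  by rewrite addr_ge0// divr_ge0//; [rewrite addr_ge0|lra].
apply: le_trans (hK _ _); last by rewrite lerDl divr_ge0//; [rewrite addr_ge0|lra].
rewrite addrAC subrr add0r mulrC divfK; last by rewrite gt_eqF//; lra.
rewrite addrK; apply: le_trans (expR_ge1Dx _).
have := ler_norm t; lra.
Qed.

Lemma tau_loglike : loglike m^-1 (tau x).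
Proof.
move=> e e0; have hm := m0.
(* The first bound keeps [m - f >= m / 2]; with the second, [f <= e m (m - f)], so replacing [m] by
   [m - f] or [m + f] moves the inverse by at most [e]. *)
pose f := Num.min (m / 2) (e * m ^+ 2 / 2).
have f0 : 0 < f.
  by rewrite lt_min !divr_gt0// mulr_gt0// exprn_gt0.
have fm : f <= m / 2 by rewrite ge_min lexx.
have fe : f <= e * m ^+ 2 / 2 by rewrite ge_min lexx orbT.
have mf0 : 0 < m - f by lra.
have mf1 : 0 < m + f by lra.
have h1 : (m - f)^-1 <= m^-1 + e.
  rewrite -(ler_pM2r mf0) mulVf ?gt_eqF// mulrDl mulrBr mulVf ?gt_eqF//.
  have -> : 1 - m^-1 * f + e * (m - f) = 1 + m^-1 * (e * m * (m - f) - f).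
    by field; rewrite gt_eqF.
  rewrite lerDl mulr_ge0 ?invr_ge0 ?(ltW m0)// subr_ge0; apply: le_trans fe _.
  have : e * m * (m / 2) <= e * m * (m - f) by rewrite ler_pM2l ?mulr_gt0//; lra.
  by apply: le_trans; rewrite -!mulrA.
have h2 : m^-1 - e <= (m + f)^-1.
  rewrite -(ler_pM2r mf1) mulVf ?gt_eqF// mulrBl mulrDr mulVf ?gt_eqF//.
  have -> : 1 + m^-1 * f - e * (m + f) = 1 - m^-1 * (e * m * (m + f) - f).
    by field; rewrite gt_eqF.
  rewrite gerBl mulr_ge0 ?invr_ge0 ?(ltW m0)// subr_ge0; apply: le_trans fe _.
  have : e * m * (m / 2) <= e * m * (m + f) by rewrite ler_pM2l ?mulr_gt0//; lra.
  by apply: le_trans; rewrite -!mulrA.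
have [|K1 K10 hK1] := @expA_lower f; first by rewrite f0/=; lra.
have [K2 K20 hK2] := expA_upper f0.
have q1 : 0 <= K1 / (m - f) by rewrite divr_ge0// ltW.
have q2 : 0 <= K2 / (m + f) by rewrite divr_ge0// ltW.
exists (1 + K1 / (m - f) + K2 / (m + f)) => t Kt.
have t1 : 1 <= t by lra.
have l0 : 0 <= ln t by rewrite ln_ge0.
have t0 : 0 < t by lra.
apply/andP; split.
- apply: tau_ge => // u u0 tu.
  have : ln t <= (m + f) * u + K2.
    by rewrite -ler_expR lnK ?posrE//; exact: le_trans tu (hK2 u u0).
  rewrite -lerBlDr mulrC -ler_pdivrMr// mulrBl => h.
  have := ler_wpM2r l0 h2; rewrite (mulrC _ (ln t)) => h3.
  rewrite (mulrC _ (ln t)) in h3 *.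
  lra.
- have q3 : 0 <= (ln t + K1) / (m - f).
    by apply: divr_ge0; [exact: addr_ge0|exact: ltW].
  (* This [u] solves [(m - f) (u - 1) - K1 = ln t], the exponent in the lower bound on [expA]. *)
  apply: le_trans (tau_le cx (u := 1 + (ln t + K1) / (m - f)) _ _) _.
  + exact: addr_ge0.
  + apply: le_trans (hK1 _ _); last by rewrite lerDl.
    by rewrite addrAC subrr add0r mulrC divfK ?gt_eqF// addrK lnK ?posrE.
  + rewrite lee_fin mulrDl; have := ler_wpM2r l0 h1.
    rewrite (mulrC _ (ln t)) => h3; lra.
Qed.

End growth.

(** * Measures with a density and image measures *)

(** The integration formula holds for the Radon-Nikodym derivative, which equals [h] almost
    everywhere since both have the same integral over every measurable set. *)
Lemma density_measure d (T : measurableType d) (R : realType)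
    (mu : {sigma_finite_measure set T -> \bar R}) (h : T -> \bar R) :
  (forall x, 0 <= h x)%E -> mu.-integrable [set: T] h ->
  exists nu : {finite_measure set T -> \bar R},
    (forall A, nu A = \int[mu]_(x in A) h x)%E /\
    forall f : T -> \bar R, measurable_fun [set: T] f -> (forall x, 0 <= f x)%E ->
      (\int[nu]_x f x = \int[mu]_x (f x * h x))%E.
Proof.
move=> h0 ih; have mh : measurable_fun setT h := measurable_int _ ih.
pose F (A : set T) := (\int[mu]_(x in A) h x)%E.
have F0 : F set0 = 0%E by rewrite /F integral_set0.
have Fge0 A : (0 <= F A)%E by apply: integral_ge0 => x _; exact: h0.
have Fsig : semi_sigma_additive F by exact: semi_sigma_additive_nng_induced.
pose nu0 : {measure set T -> \bar R} :=
  HB.pack_for (Measure.type T R) F (isMeasure.Build _ _ _ F F0 Fge0 Fsig).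
have finF : fin_num_fun nu0.
  by move=> A mA; apply: integrable_fin_num => //; exact: integrableS ih.
have sfin : sigma_finite setT nu0.
  by apply: (@fin_num_fun_sigma_finite _ _ _ nu0) => //; rewrite measure0.
pose H1 := isFinite.Build _ _ _ _ finF.
pose H2 := isSFinite.Build _ _ _ _ (sfinite_measure_sigma_finite sfin).
pose H3 := isSigmaFinite.Build _ _ _ _ sfin.
pose nu := HB.pack_for (FiniteMeasure.type T R) (Measure.sort nu0) H1 H2 H3.
exists nu; split => // f mf f0.
have dom : nu `<< mu.
  by apply/null_content_dominatesP => A mA muA;
    apply: null_set_integral => //; exact: measurable_funTS.
rewrite -(Radon_Nikodym_SigmaFinite.change_of_variables dom f0)//.
apply: ae_eq_integral => //.
- apply: emeasurable_funM => //.
  exact: measurable_int (Radon_Nikodym_SigmaFinite.f_integrable dom).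
- exact: emeasurable_funM.
- apply: ae_eqe_mul2l; apply: integral_ae_eq => //.
    exact: Radon_Nikodym_SigmaFinite.f_integrable.
  move=> A _ mA; rewrite -Radon_Nikodym_SigmaFinite.f_integral//.
Qed.

Lemma image_measure d d' (T : measurableType d) (T' : measurableType d')
    (R : realType) (mu : {measure set T -> \bar R}) (D : set T) (s : T -> T') :
  measurable D -> measurable_fun [set: T] s ->
  exists nu : {measure set T' -> \bar R},
    (forall A, nu A = mu (D `&` s @^-1` A)) /\
    forall f : T' -> \bar R, measurable_fun [set: T'] f -> (forall x, 0 <= f x)%E ->
      (\int[nu]_y f y = \int[mu]_(x in D) f (s x))%E.
Proof.
move=> mD ms.
pose F := pushforward (mrestr mu mD) s.
pose nu := HB.pack_for (Measure.type T' R) F.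
exists (nu ms); split => [A|f mf f0].
  by rewrite setIC.
rewrite -(ge0_integral_mrestr _ mD); last 2 first.
- exact: measurableT_comp.
- by move=> x; exact: f0.
have := ge0_integral_pushforward ms (mrestr mu mD) measurableT mf (fun y _ => f0 y).
by rewrite preimage_setT.
Qed.

(** * Inversion of the exponential functional and the Lamperti clock *)

Section time_change.
Context (R : realType) (x : R -> R).
Hypothesis cx : cadlag x.
Hypothesis unboundedA : forall t, exists2 u, 0 <= u & t <= expA x u.

Definition ftau (t : R) : R := fine (tau x t).

Lemma tauE t : tau x t = (ftau t)%:E.
Proof.
rewrite /ftau fineK// ge0_fin_numE ?tau_ge0//.
have [u u0 tu] := unboundedA t.
by apply: le_lt_trans (tau_le cx u0 tu) _; exact: ltry.
Qed.

Lemma ftau_ge0 t : 0 <= ftau t.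
Proof. by rewrite -lee_fin -tauE tau_ge0. Qed.

(** A Galois connection between [ftau] and [expA]. If [expA x b < t], the Lipschitz bound keeps
    [expA] below [t] for a while after [b], so the infimum lies strictly beyond [b]. *)
Lemma ftau_le t b : 0 <= b -> (ftau t <= b) = (t <= expA x b).
Proof.
move=> b0; apply/idP/idP; last by move=> h; rewrite -lee_fin -tauE tau_le.
apply: contraTT; rewrite -!ltNge => bt.
have [C C0 hC] := expA_lipschitz cx (b + 1).
(* The cap at [1] stays in the range [[0, b + 1]] where the constant [C] is valid. *)
pose e := Num.min 1 ((t - expA x b) / C).
have e0 : 0 < e by rewrite lt_min ltr01 divr_gt0// subr_gt0.
apply: (@lt_le_trans _ _ (b + e)); first by rewrite ltrDl.
rewrite -lee_fin -tauE; apply: (tau_ge cx) => u u0 tu.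
have bu : b < u.
  rewrite ltNge; apply/negP => ub.
  have : expA x u <= expA x b by apply: expA_le => //; rewrite u0.
  by move=> /(le_trans tu); rewrite leNgt bt.
have [ub1|/ltW ub1] := leP u (b + 1); last first.
  by apply: le_trans ub1; rewrite lerD2l ge_min lexx.
have := hC b u; rewrite b0 (ltW bu) => /(_ isT ub1) h.
have : e <= (t - expA x b) / C by rewrite ge_min lexx orbT.
rewrite ler_pdivlMr// => h2.
have : e * C <= (u - b) * C by lra.
by rewrite ler_pM2r//; lra.
Qed.

(** An overshoot at [ftau t] would, by the Lipschitz bound, mean that level [t] was already reached
    earlier. *)
Lemma expA_ftau t : 0 <= t -> expA x (ftau t) = t.
Proof.
move=> t0; apply/eqP; rewrite eq_le -ftau_le ?ftau_ge0// lexx andbT.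
have U0 := ftau_ge0 t; set U := ftau t in U0 *.
rewrite leNgt; apply/negP => tU.
have [C C0 hC] := expA_lipschitz cx U.
pose e := (expA x U - t) / C.
have e0 : 0 < e by rewrite divr_gt0// subr_gt0.
have Upos : 0 < U.
  rewrite lt_neqAle U0 andbT; apply/eqP => U00.
  by move: tU; rewrite -U00 expA0 ltNge t0.
pose u := Num.max 0 (U - e).
have u0 : 0 <= u by rewrite le_max lexx.
have uU : u < U by rewrite gt_max Upos gtrBl.
have := hC u U; rewrite u0 (ltW uU) => /(_ isT (lexx _)) h.
have hu : U - u <= e.
  have : U - e <= u by rewrite le_max lexx orbT.
  lra.
have : C * (U - u) <= C * e by rewrite ler_pM2l.
rewrite /e (mulrC C (_ / _)) divfK ?gt_eqF// => h2.
have : t <= expA x u by lra.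
by rewrite -ftau_le// -/U leNgt uU.
Qed.

Lemma ftau_nondecreasing : nondecreasing_fun ftau.
Proof.
move=> s t st; rewrite ftau_le ?ftau_ge0//; apply: (le_trans st).
by rewrite -ftau_le ?ftau_ge0.
Qed.

(* The clock is the integral of [exp (- x) / a] against the image of Lebesgue
   measure on [[0, t]] by [r |-> tau (r / a)].  This image is the measure with
   density [a exp x] on [[0, tau (t / a)]]: they agree on half-lines because
   [tau r <= b] is equivalent to [r <= A b]. *)
Lemma clock_lamperti a t : 0 < a -> 0 <= t ->
  clock (lamperti a x) t = tau x (t / a).
Proof.
move=> a0 t0.
pose s r := ftau (r / a).
have ms : measurable_fun [set: R] s.
  apply: nondecreasing_measurable => // r1 r2 r12.
  by apply: ftau_nondecreasing; rewrite ler_pM2r ?invr_gt0.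
set U := ftau (t / a).
have U0 : 0 <= U := ftau_ge0 _.
have ta0 : 0 <= t / a by rewrite divr_ge0// ltW.
have AU : expA x U = t / a by rewrite expA_ftau.
have mx := measurable_cadlag cx.
pose g (u : R) : \bar R := (a%:E * (expR (x (Num.max 0 u)))%:E)%E.
have mg : measurable_fun [set: R] g.
  by apply: measurable_funeM; apply/measurable_EFinP; exact: measurableT_comp.
have g0 u : (0 <= g u)%E by rewrite /g -EFinM lee_fin mulr_ge0 ?expR_ge0// ltW.
have gint (D : set R) : measurable D -> (\int[lebesgue_measure]_(u in D) g u =
    a%:E * \int[lebesgue_measure]_(u in D) (expR (x (Num.max 0 u)))%:E)%E.
  move=> mD; rewrite ge0_integralZl_EFin//; last exact: ltW.
  apply: measurable_funTS; apply/measurable_EFinP; exact: measurableT_comp.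
pose h := g \_ `[0, U].
have hint (D : set R) : measurable D -> (\int[lebesgue_measure]_(u in D) h u =
    a%:E * \int[lebesgue_measure]_(u in D `&` `[0%R, U]) (expR (x (Num.max 0 u)))%:E)%E.
  by move=> mD; rewrite -gint ?integral_mkcondr//; exact: measurableI.
have mh : measurable_fun [set: R] h.
  by apply/(measurable_restrictT g) => //; apply: measurable_funTS.
have h0 u : (0 <= h u)%E by rewrite /h erestrict_ge0.
have ih : lebesgue_measure.-integrable [set: R] h.
  apply/integrableP; split => //; under eq_integral do rewrite gee0_abs//.
  by rewrite hint// setTI integral_exp_path_cc// -EFinM ltry.
have [nu [nuE nuf]] := @density_measure _ _ R (@lebesgue_measure R) h h0 ih.
have [im [imE imf]] := @image_measure _ _ (measurableTypeR R) (measurableTypeR R) _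
  (@lebesgue_measure R) `[0, t]%classic s
  (measurable_itv _) ms.
have l0t : lebesgue_measure (`[0, t]%classic : set R) = t%:E.
  rewrite lebesgue_measure_itv/= lte_fin oppr0 adde0.
  by case: ltgtP t0 => // <-.
have imnu A : measurable A -> im A = nu A.
  apply: (@measure_unique _ R (measurableTypeR R) (@RGenOInfty.G R)
    (fun n => `]- n%:R, +oo[%classic) _ _ _ _ im nu).
  - exact: RGenOInfty.measurableE.
  - move=> _ _ [b ->] [c ->]; exists (Num.max b c).
    by apply/seteqP; split => r /=; rewrite !in_itv/= !andbT gt_max => /andP.
  - by move=> n; eexists.
  - apply/seteqP; split => // r _; exists (Num.truncn `|r|).+1 => //=.
    rewrite in_itv/= andbT.
    have := real_truncnS_gt (num_real `|r|); have := ler_norm (- r).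
    rewrite normrN; lra.
  - move=> _ [b ->].
    apply: etrans; [exact: imE|apply: esym].
    apply: etrans; [exact: nuE|rewrite hint//].
    (* A half-line starting below [0] has full mass on both sides: [t] for the image, and
       [a * expA x U = t] for the density. *)
    have [b0|b0] := ltP b 0.
      have -> : `]b, +oo[%classic `&` `[0, U]%classic = `[0, U]%classic.
        apply/setIidPr => r /=; rewrite !in_itv/= andbT => /andP[r0 _].
        exact: lt_le_trans r0.
      have -> : `[0, t]%classic `&` s @^-1` `]b, +oo[ = `[0, t]%classic.
        apply/setIidPl => r /= _; rewrite in_itv/= andbT.
        exact: lt_le_trans b0 (ftau_ge0 _).
      by rewrite integral_exp_path_cc// AU -EFinM mulrC divfK ?gt_eqF//.
    have -> : `]b, +oo[%classic `&` `[0, U]%classic = `]b, U]%classic.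
      apply/seteqP; split => r /=; rewrite !in_itv/= andbT.
        by move=> [-> /andP[_ ->]].
      by move=> /andP[br ->]; rewrite br (ltW (le_lt_trans b0 br)).
    have -> : `[0, t]%classic `&` s @^-1` `]b, +oo[ = `]a * expA x b, t]%classic.
      apply/seteqP; split => r /=; rewrite !in_itv/= andbT /s (ltNge b)
        ftau_le// -ltNge ltr_pdivlMr// (mulrC a).
        by move=> [/andP[_ ->] ->].
      move=> /andP[abr ->]; rewrite abr (ltW (le_lt_trans _ abr))//.
      by rewrite mulr_ge0 ?expA_ge0// ltW.
    have [bU|Ub] := leP b U.
      rewrite integral_exp_path_oc ?b0// AU.
      rewrite -EFinM mulrBr (mulrC a (t / a)) divfK ?gt_eqF//.
      apply/esym; apply: etrans; [exact: lebesgue_measure_itv|].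
      have : a * expA x b <= t.
        by rewrite mulrC -ler_pdivlMr// -AU expA_le// b0.
      by rewrite /= lte_fin -EFinB; case: ltgtP => // -> _; rewrite subrr.
    have -> : `]b, U]%classic = set0.
      by apply/seteqP; split => // r /=; rewrite in_itv/= => /andP[]; lra.
    rewrite integral_set0 mule0.
    apply/esym; apply: etrans; [exact: lebesgue_measure_itv|].
    rewrite /= lte_fin ltNge.
    have -> // : t <= a * expA x b.
    rewrite mulrC -ler_pdivrMr// -AU expA_le// U0/=; exact: ltW.
  - move=> n; apply: (@le_lt_trans _ _ (lebesgue_measure (`[0, t]%classic : set R))).
      apply: (@le_trans _ _ (lebesgue_measure
        (`[0, t]%classic `&` s @^-1` `]- n%:R, +oo[ : set R))).
        by rewrite le_eqVlt; apply/orP; left; apply/eqP; exact: imE.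
      apply: le_measure; rewrite ?inE//.
      apply: measurableI => //.
      by rewrite -[X in measurable X]setTI; exact: ms.
    by rewrite l0t ltry.
pose f (u : R) : \bar R := (a^-1 * expR (- x (Num.max 0 u)))%:E.
have mf : measurable_fun [set: R] f.
  apply/measurable_EFinP; apply: measurable_funM => //.
  by apply: measurableT_comp => //; exact: measurable_funN.
have f0 u : (0 <= f u)%E by rewrite lee_fin mulr_ge0 ?expR_ge0// invr_ge0 ltW.
transitivity (\int[im]_u f u)%E.
  rewrite imf//; apply: eq_integral => r _.
  rewrite /lamperti -/(ftau _) inver gt_eqF ?mulr_gt0 ?expR_gt0// /f.
  by rewrite max_r ?ftau_ge0// invfM expRN.
transitivity (\int[nu]_u f u)%E.
  by apply: eq_measure_integral => A mA _; exact: imnu.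
rewrite nuf//.
(* The density [a exp x] cancels the integrand [f], leaving the length of [[0, U]]. *)
transitivity (\int[lebesgue_measure]_u ((cst 1%E : R -> \bar R) \_ `[0%R, U]) u)%E.
  apply: eq_integral => u _; rewrite /h /patch; case: ifPn => _; last by rewrite mule0.
  rewrite /g /f -!EFinM expRN mulrACA mulVf ?gt_eqF// mulVf ?gt_eqF ?expR_gt0//.
  by rewrite mulr1.
rewrite -integral_mkcond integral_cst//= lebesgue_measure_itv/= lte_fin tauE -/U.
case: ltgtP U0 => // [U0 _|<- _]; last by rewrite mule0.
by rewrite mul1e oppr0 adde0.
Qed.

End time_change.

(** * Measurability and monotonicity of the clock on path space *)

Section clock_path_space.
Context (R : realType).

Lemma measurable_path_eval t : 0 <= t ->
  measurable_fun [set: path_space R] (fun y : path_space R => y t).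
Proof.
move=> t0 _ B mB; rewrite setTI; apply: sub_sigma_algebra.
by exists t, B.
Qed.

Let g (q : path_space R * R) : \bar R := ((q.1 (Num.max 0 q.2))%:E^-1)%E.

Let g0 q : (0 <= g q)%E.
Proof. by rewrite inve_ge0 lee_fin; apply: path_ge0; rewrite le_max lexx. Qed.

Let mg : measurable_fun [set: path_space R * R] g.
Proof.
have my := measurable_cadlag_family measurable_path_eval (@path_cadlag R).
(* A path may take the value [0], where the extended inverse is [+oo]; elsewhere the inverse is a
   real power. *)
rewrite (_ : g = fun q => if q.1 (Num.max 0 q.2) == 0 then +oo%E
    else (powR (q.1 (Num.max 0 q.2)) (-1))%:E).
  apply: measurable_fun_ifT => //.
    by apply: measurable_fun_eqr.
  by apply/measurable_EFinP; exact: measurableT_comp (measurable_powR (-1)) my.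
apply/funext => q; rewrite /g inver powR_inv1//.
by apply: path_ge0; rewrite le_max lexx.
Qed.

Let clockE (y : path_space R) t :
  clock y t = (\int[lebesgue_measure]_(s in `[0%R, t]) g (y, s))%E.
Proof.
apply: eq_integral => s; rewrite inE/= in_itv/= => /andP[s0 _].
by rewrite /g /= max_r.
Qed.

Lemma measurable_clock t :
  measurable_fun [set: path_space R] (fun y : path_space R => clock y t).
Proof.
pose f := g \_ (setT `*` `[0, t]).
have mf : measurable_fun [set: path_space R * R] f.
  apply/(measurable_restrictT g); last exact: measurable_funTS.
  exact: measurableX.
have f0 q : (0 <= f q)%E by rewrite /f erestrict_ge0.
have := @measurable_fun_fubini_tonelli_F _ _ (path_space R) (measurableTypeR R) R
  (@lebesgue_measure R) f mf f0.
apply: eq_measurable_fun => y _.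
rewrite /fubini_F clockE [RHS]integral_mkcond; apply: eq_integral => s _.
by rewrite /f /patch in_setX in_setT.
Qed.

Lemma clock_le (y : path_space R) s t : s <= t -> (clock y s <= clock y t)%E.
Proof.
move=> st; rewrite !clockE; apply: ge0_subset_integral => //.
- by apply: measurable_funTS; exact: measurableT_comp mg (pair1_measurable y).
- by move=> r /=; rewrite !in_itv/= => /andP[-> /le_trans]; apply.
Qed.

End clock_path_space.

(** * Logarithmic growth along the reals and along the integers *)

Section loglike.
Context (R : realType).
Implicit Types (c : R) (F : R -> \bar R).

Lemma loglike_cvg c F : loglike c F ->
  (F t / (ln t)%:E)%E @[t --> +oo] --> c%:E.
Proof.
move=> lF.
have ln_ge M : \forall t \near +oo, M <= ln t :> R.
  near=> t; have Mt : expR M <= t by near: t; exact: nbhs_pinfty_ge (num_real _).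
  by rewrite -[M]expRK ler_ln ?posrE ?expR_gt0// (lt_le_trans (expR_gt0 M)).
have main e : 0 < e -> \forall t \near +oo,
    [/\ 0 < ln t, F t \is a fin_num & `|c - fine (F t) / ln t| <= e].
  move=> e0; have e20 : 0 < e / 2 by rewrite divr_gt0.
  have [K hK] := lF _ e20.
  near=> t.
  have l1 : 1 <= ln t by near: t; exact: ln_ge.
  (* Half of [e] is the slope error; the other half, times [ln t], covers [K]. *)
  have l2 : `|K| / (e / 2) <= ln t by near: t; exact: ln_ge.
  have Kt : K <= t by near: t; exact: nbhs_pinfty_ge (num_real _).
  have lt0 : 0 < ln t by lra.
  have /andP[h1 h2] := hK t Kt.
  have Ffin : F t \is a fin_num.
    by rewrite fin_numElt (lt_le_trans (ltNyr _) h1) (le_lt_trans h2 (ltry _)).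
  split => //.
  move: h1 h2; rewrite -(fineK Ffin) !lee_fin => h1 h2.
  have h3 : `|K| <= e / 2 * ln t by rewrite mulrC -ler_pdivrMr.
  have := ler_norm K; have hn := ler_norm (- K); rewrite normrN in hn => hp.
  rewrite ler_distlC ler_pdivlMr// ler_pdivrMr//; apply/andP; split; lra.
have ev : {near +oo%R, (fun t => (fine (F t) / ln t)%:E) =1 (fun t => F t / (ln t)%:E)%E}.
  near=> t; have [l0 Ffin _] : [/\ 0 < ln t, F t \is a fin_num & `|c - fine (F t) / ln t| <= 1].
    by near: t; exact: main.
  by rewrite EFinM inver gt_eqF// fineK.
apply: cvg_trans; first exact: (near_eq_cvg ev).
apply: cvg_EFin; first exact: nearW.
apply/cvgrPdist_le => e /main; apply: filterS => t [_ _].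
by [].
Unshelve. all: by end_near. Qed.

(** Dividing [t] by [a] shifts the logarithm by the constant [ln a], which [K] absorbs. *)
Lemma loglike_scale c F a : 0 < a -> loglike c F -> loglike c (fun t => F (t / a)).
Proof.
move=> a0 lF e e0; have [K hK] := lF e e0.
exists (a * `|K| + 1 + `|K| + `|(c - e) * ln a| + `|(c + e) * ln a|) => t Kt.
have aK : 0 <= a * `|K| by rewrite mulr_ge0// ltW.
have n1 := normr_ge0 K.
have n2 := normr_ge0 ((c - e) * ln a).
have n3 := normr_ge0 ((c + e) * ln a).
have t0 : 0 < t by lra.
have Kta : K <= t / a.
  by rewrite ler_pdivlMr// mulrC; have := ler_norm K; rewrite -(ler_pM2l a0); lra.
have /andP[h1 h2] := hK _ Kta.
have lna : ln (t / a) = ln t - ln a by rewrite ln_div ?posrE.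
have := ler_norm K; have := ler_norm ((c - e) * ln a); have := ler_norm (- ((c + e) * ln a)).
rewrite normrN => b1 b2 b3.
apply/andP; split.
  by apply: le_trans h1; rewrite lee_fin lna; lra.
by apply: le_trans h2 _; rewrite lee_fin lna; lra.
Qed.

(* For monotone [F], equivalent to [loglike], but with countable quantifiers. *)
Definition loglike_nat c F :=
  forall k : nat, exists K : nat, forall n : nat, (K <= n)%N ->
    (((c - k.+1%:R^-1) * ln n%:R - K%:R)%:E <= F n%:R
      <= ((c + k.+1%:R^-1) * ln n%:R + K%:R)%:E)%E.

Lemma loglike_loglike_nat c F : loglike c F -> loglike_nat c F.
Proof.
move=> lF k; have [K hK] := lF k.+1%:R^-1 ltac:(by rewrite invr_gt0).
have KN : K <= (Num.truncn `|K|).+1%:R.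
  by apply: le_trans (ler_norm K) _; apply/ltW; rewrite real_truncnS_gt// num_real.
exists (Num.truncn `|K|).+1 => n Kn.
have Kn' : K <= n%:R by apply: le_trans KN _; rewrite ler_nat.
have /andP[h1 h2] := hK _ Kn'; apply/andP; split.
  by apply: le_trans h1; rewrite lee_fin lerD2l lerN2.
by apply: le_trans h2 _; rewrite lee_fin lerD2l.
Qed.

(** Monotonicity places [F t] between its values at the integers around [t]. The logarithms of these
    differ from [ln t] by at most [1], as the ratios are at most [2 <= expR 1]. *)
Lemma loglike_nat_loglike c F : (forall s t, s <= t -> (F s <= F t)%E) ->
  loglike_nat c F -> loglike c F.
Proof.
move=> Fmon lF e e0.
have ke : (Num.truncn e^-1).+1%:R^-1 <= e.
  rewrite invf_ple ?posrE//; apply/ltW; exact: real_truncnS_gt (num_real _).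
set k := Num.truncn e^-1 in ke; have [K hK] := lF k.
set f := k.+1%:R^-1 in hK ke.
exists (K%:R + `|c - f| + `|c + f| + 2) => t Kt.
have K0 : 0 <= K%:R :> R by [].
have n1 := normr_ge0 (c - f); have n2 := normr_ge0 (c + f).
have t2 : 2 <= t by lra.
have t0 : 0 < t by lra.
have lt0 : 0 <= ln t by rewrite ln_ge0//; lra.
have /truncn_itv/andP[nt tn] : 0 <= t by lra.
set n := Num.truncn t in nt tn.
have Kn : (K <= n)%N by rewrite -ltnS -(ltr_nat R); apply: le_lt_trans tn; lra.
have n0 : 1 <= n%:R :> R.
  rewrite ler1n -ltnS -(ltr_nat R); apply: le_lt_trans tn; lra.
have e2 : 2 <= expR 1 :> R by have := @expR_ge1Dx R 1; lra.
have lnS : ln n.+1%:R <= ln t + 1.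
  rewrite -ler_expR lnK ?posrE ?ltr0n// expRD lnK ?posrE//.
  have : t * 2 <= t * expR 1 by rewrite ler_pM2l.
  by rewrite -natr1; lra.
have lnn : ln t - 1 <= ln n%:R.
  rewrite -ler_expR expRD expRN !lnK ?posrE//; last lra.
  rewrite ler_pdivrMr ?expR_gt0//.
  have : n%:R * 2 <= n%:R * expR 1 :> R by rewrite ler_pM2l//; lra.
  move: tn; rewrite -natr1; lra.
have ln1 : ln n%:R <= ln t by rewrite ler_ln ?posrE//; lra.
have ln2 : ln t <= ln n.+1%:R by rewrite ler_ln ?posrE ?ltr0n//; exact: ltW.
have /andP[h1 _] := hK n Kn.
have /andP[_ h2] := hK n.+1 (leqW Kn).
have dist (C u v : R) : `|u - v| <= 1 -> C * u <= C * v + `|C|.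
  move=> uv; rewrite -lerBlDl -mulrBr; apply: le_trans (ler_norm _) _.
  by rewrite normrM ler_piMr.
have d1 : `|ln t - ln n%:R| <= 1 by rewrite ler_norml; lra.
have d2 : `|ln n.+1%:R - ln t| <= 1 by rewrite ler_norml; lra.
have D1 := dist (c - f) _ _ d1; have D2 := dist (c + f) _ _ d2.
have E1 : (c - e) * ln t <= (c - f) * ln t by rewrite ler_wpM2r// lerD2l lerN2.
have E2 : (c + f) * ln t <= (c + e) * ln t by rewrite ler_wpM2r// lerD2l.
apply/andP; split.
  apply: le_trans (Fmon _ _ nt); apply: le_trans h1; rewrite lee_fin; lra.
apply: le_trans (Fmon _ _ (ltW tn)) _; apply: le_trans h2 _; rewrite lee_fin; lra.
Qed.

End loglike.

(** * Transfer of the growth of the clock to the laws [Q a] *)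

Section clock_growth.
Context (R : realType).

Lemma measurable_clock_loglike_nat (c : R) :
  measurable [set y : path_space R | loglike_nat c (clock y)].
Proof.
rewrite (_ : [set _ | _] = \bigcap_k \bigcup_K \bigcap_(n in [set n | (K <= n)%N])
   (fun y : path_space R => clock y n%:R) @^-1`
     `[((c - k.+1%:R^-1) * ln n%:R - K%:R)%:E,
       ((c + k.+1%:R^-1) * ln n%:R + K%:R)%:E]).
  apply: bigcapT_measurable => k; apply: bigcupT_measurable => K.
  apply: bigcap_measurableType => n _.
  rewrite -[X in measurable X]setTI; apply: measurable_clock => //.
  exact: emeasurable_itv.
apply/seteqP; split => y h k.
  move=> _; have [K hK] := h k; by exists K.
have [K _ hK] := h k I; exists K => n Kn.
by have := hK n Kn; rewrite /= in_itv/=.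
Qed.

End clock_growth.

Theorem theorem1 (R : realType) (d : measure_display) (T : measurableType d)
    (P : probability T R) (xi : R -> T -> R)
    (Q : R -> probability (path_space R) R) :
  levy_process P xi ->
  P.-integrable [set: T] (EFin \o xi 1%R) ->
  (0 < 'E_P[xi 1%R])%E ->
  associated_pssMp P xi Q ->
  (forall a : R, 0 < a ->
    {ae Q a, forall x : path_space R,
      (clock x t / (ln t)%:E)%E @[t --> +oo] --> (('E_P[xi 1%R])^-1)%E}) /\
  {ae P, forall w : T,
    (tau (fun s => xi s w) t / (ln t)%:E)%E @[t --> +oo] --> (('E_P[xi 1%R])^-1)%E}.
Proof.
move=> lxi intxi E0 assoc.
pose m := fine (\int[P]_w (xi 1 w)%:E)%E.
have Em : ('E_P[xi 1%R] = m%:E)%E by rewrite unlock fineK// integrable_fin_num.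
have m0 : 0 < m by move: E0; rewrite Em lte_fin.
rewrite Em inver gt_eqF//.
have growth := levy_linear_growth lxi intxi.
split; last first.
  apply: filterS2 (levy_cadlag lxi) growth => w cw gw.
  exact: loglike_cvg (tau_loglike cw m0 gw).
move=> a a0; have [Y [YX QY]] := assoc a a0.
pose C := [set y : path_space R | loglike_nat m^-1 (clock y)].
have mC : measurable C := measurable_clock_loglike_nat _.
(* [C] is measurable and implies the convergence; the mass of its complement under [Q a] is computed
   under [P] through [Y]. *)
exists (~` C); split.
- exact: measurableC.
- have -> : Q a (~` C) = P (Y @^-1` (~` C)) by rewrite QY//; exact: measurableC.
  apply/negligibleP.
    by rewrite -[X in measurable X]setTI; apply: measurable_funPT => //; exact: measurableC.
  have : {ae P, forall w, C (Y w)}.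
    apply: filterS3 YX (levy_cadlag lxi) growth => w Yw cw gw k.
    have unb := expA_unbounded cw m0 gw.
    have lt := loglike_scale a0 (tau_loglike cw m0 gw).
    have [K hK'] := loglike_loglike_nat lt k.
    exists K => n Kn; have := hK' n Kn.
    rewrite -(clock_lamperti cw unb a0)//.
    (* Only nonnegative times enter the clock, and there [Y w] agrees with the Lamperti
       transform. *)
    suff -> : clock (lamperti a (fun t => xi t w)) n%:R = clock (Y w) n%:R by [].
    apply: eq_integral => s; rewrite inE/= in_itv/= => /andP[s0 _].
    by rewrite Yw.
  by apply: negligibleS.
- move=> y /= ncv Cy; apply: ncv; apply: loglike_cvg.
  by apply: loglike_nat_loglike Cy => s t; exact: clock_le.
Qed.
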